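(* There is a randomized LOCAL algorithm that, with high probability, computes a hypergraph sinkless orientation on any $n$-node hypergraph with rank $r$ and minimum degree $\delta\ge 320\, r\log r$, with running time $O(\log_{\delta/r}\delta+\log_{\delta/r}\log n)$ rounds. Moreover, if $r\ge 100\log n$, an alternative randomized algorithm solves the problem with high probability in $O(\log\log n/\log\log\log n)$ rounds.
   Context: The degree of a vertex is the number of hyperedges containing it; the rank of a hyperedge is its number of vertices, and the rank of the hypergraph is the maximum rank. A hypergraph sinkless orientation (HSO) orients each hyperedge so that it is outgoing for exactly one of its vertices and incoming for all others, such that every vertex has at least one outgoing hyperedge. LOCAL on a hypergraph means the LOCAL model on its bipartite representation (vertices on one side, hyperedges on the other, adjacency by incidence): nodes have unique IDs, communicate in synchronous rounds with unbounded local computation and message size. ''With high probability'' means with probability at least $1-1/\mathrm{poly}(n)$. *)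

(* Defs.v *)
From HB Require Import structures.
From mathcomp Require Import all_boot all_order all_algebra.
From mathcomp Require Import reals exp.

Set Implicit Arguments.
Unset Strict Implicit.
Unset Printing Implicit Defensive.

(* Hyperedges form a family of nonempty vertex sets, so distinct hyperedges
   may consist of the same vertices. *)
Record hypergraph := Hypergraph {
  vertex : finType;
  hyperedge : finType;
  ends : hyperedge -> {set vertex};
  ends_neq0 : forall e, ends e != set0
}.

Section Hypergraph.
Variable H : hypergraph.

Definition degree (v : vertex H) : nat := #|[set e | v \in ends e]|.

Definition rank : nat := \max_(e : hyperedge H) #|ends e|.

(* Degrees are at most the number of hyperedges, so this is the minimum as soon
   as there is a vertex. *)
Definition min_degree : nat :=
  \big[minn/#|hyperedge H|]_(v : vertex H) degree v.

(* [out v e] reads: the hyperedge [e] is outgoing for its vertex [v]; if false,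
   it is incoming for [v]. The values at [v \notin ends e] are irrelevant. *)
Definition is_hso (out : vertex H -> hyperedge H -> bool) : bool :=
  [forall e, #|[set v in ends e | out v e]| == 1] &&
  [forall v, exists e, (v \in ends e) && out v e].

Definition bip_node : finType := (vertex H + hyperedge H)%type.

Definition bip_adj : rel bip_node := fun x y =>
  match x, y with
  | inl v, inr e => v \in ends e
  | inr e, inl v => v \in ends e
  | _, _ => false
  end.

Definition is_vertex (x : bip_node) : bool := if x is inl _ then true else false.

End Hypergraph.

(* A randomized algorithm in the LOCAL model, with local inputs in [I] and local
   outputs in [O]. A node starts with its input, its identifier, its degree and
   a private random seed. In every round it sends to each neighbour a message
   that may depend on the neighbour's identifier, and updates its state from the
   list of all received messages, each tagged with the identifier of its
   sender. There is no restriction on states, messages and local computations;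
   all nodes stop after [rounds] rounds. *)
Record local_algorithm (I O : Type) := LocalAlgorithm {
  state : Type;
  message : Type;
  seed : finType;
  rounds : nat;
  init : I -> nat -> nat -> seed -> state;
  send : state -> nat -> message;
  receive : state -> seq (nat * message) -> state;
  output : state -> O
}.

Section Execution.
Variables (I O : Type) (A : local_algorithm I O).
Variables (N : finType) (adj : rel N) (input : N -> I) (id : N -> nat).

(* Sorting by identifier makes the inbox independent of the enumeration of the
   finite type [N]. *)
Definition neighbours (x : N) : seq N :=
  sort (relpre id leq) (enum (adj x)).

Definition round (st : N -> state A) (x : N) : state A :=
  receive (st x) [seq (id y, send (st y) (id x)) | y <- neighbours x].

Definition execute (s : {ffun N -> seed A}) (x : N) : O :=
  output (iter (rounds A) round
    (fun y => init (input y) (id y) (size (neighbours y)) (s y)) x).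

(* Probability of [P], a property of the outputs of all nodes, when the seeds
   of the nodes are independent and uniformly distributed. *)
Definition success_prob (R : realType) (P : (N -> O) -> bool) : R :=
  (#|[set s : {ffun N -> seed A} | P (execute s)]|%:R /
   #|{ffun N -> seed A}|%:R)%R.

End Execution.

(* The input of a node is its side of the bipartite representation. The output
   of a hyperedge is the identifier of the vertex for which it is outgoing; the
   output of a vertex is ignored. *)
Definition hso_prob (R : realType) (A : local_algorithm bool nat)
    (H : hypergraph) (id : bip_node H -> nat) : R :=
  success_prob A (@bip_adj H) (@is_vertex H) id R
    (fun o => is_hso (fun v e => o (inr e) == id (inl v))).

Definition logb (R : realType) (b x : R) : R := (ln x / ln b)%R.

Definition log2 (R : realType) (x : R) : R := logb 2%:R%R x.

(* Main.v *)
(* Every hyperedge keeps a random block of r' of its vertices (all of them, unless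
   r is large compared with log n) and every vertex uses d of the hyperedges that
   kept it. Each hyperedge is active with probability 1/2, and an active one
   points to a random vertex, unless one of its vertices sees too few inactive
   hyperedges. A vertex stays unsatisfied with probability at most d^-10, and
   every unsatisfied vertex keeps at least d/8 free hyperedges. Since distant
   vertices behave independently, a union bound over depth-first traversals of
   trees of log n separated vertices shows that, with high probability, the
   balls of radius t in the hypergraph of unsatisfied vertices and free
   hyperedges have at most poly(d) log n vertices.

   As d/8r' to the power t exceeds this size, an expansion argument yields around
   every unsatisfied vertex v a set W of unsatisfied vertices containing v that
   can be matched into the free hyperedges whose unsatisfied vertices all lie in
   W. Such local solutions never conflict once each vertex follows the solution
   with the smallest center among those that contain it. *)

Require Import Defs.
From mathcomp Require Import all_boot all_order all_algebra.
From mathcomp Require Import boolp reals sequences exp.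
From mathcomp Require Import zify ring lra.

Set Implicit Arguments.
Unset Strict Implicit.
Unset Printing Implicit Defensive.

Import Order.TTheory GRing.Theory Num.Theory.

(** * Hall's theorem, globally and in small balls *)

(** The exponents come from one balance. A vertex shares hyperedges with at most d r' <= d^2
    vertices, and whether it is satisfied depends on coins of its own hyperedges and of those of
    these vertices. Vertices more than three such links apart are therefore independent, and a
    maximal separated set can be traversed by moves of at most four links, with (d r')^4 <= d^8
    targets each. A failure probability of d^-10 beats this. It is a union of at most d^2 elementary
    failures, so each of these must have probability d^-12, which amounts to d >= 24 r' ln d.

    The obstacle for large r is the running time: with a degree close to 320 r log r, the logarithm
    of the degree in base degree/r grows with r. Blocks of order log n vertices make ln r' of order
    log log n, while d/r' stays at least of order log r, hence of order log log n. This ratio is the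
    base of the logarithm that bounds the radius, and so it yields the denominator log log log n. *)

Lemma hall (T E : finType) (e0 : E) (A : {set T}) (N : T -> {set E}) :
  (forall X : {set T}, X \subset A -> #|X| <= #|\bigcup_(x in X) N x|) ->
  exists f : T -> E, {in A &, injective f} /\ {in A, forall x, f x \in N x}.
Proof.
have [k] := ubnP #|A|; elim: k A N => // k IHk A N ltAk hallA.
(* Either some nonempty proper subset is tight, and it is matched separately from its complement,
   which avoids its neighbours; or all such subsets have a neighbour to spare, and any single pair
   can be matched and removed. *)
have [/existsP[X /and4P[XA X0 XnA /eqP cX]]|noX] := boolP [exists X : {set T},
    [&& X \subset A, X != set0, X != A & #|\bigcup_(x in X) N x| == #|X|]].
  have XpA : X \proper A by rewrite properEneq XnA.
  have ltX : #|X| < k by rewrite (leq_trans (proper_card XpA)) // -ltnS.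
  have [||f [injf fN]] := IHk X N => //.
    by move=> Y YX; apply/hallA/(subset_trans YX).
  have ltD : #|A :\: X| < k.
    rewrite cardsD (setIidPr XA); have := subset_leq_card XA.
    by move: X0 ltAk; rewrite -card_gt0; lia.
  have [||g [injg gN]] := IHk (A :\: X) (fun x => N x :\: \bigcup_(x in X) N x) => //.
    move=> Y YD.
    have YX : [disjoint X & Y].
      by rewrite disjoint_sym; move: YD; rewrite subsetD => /andP[].
    have := hallA (X :|: Y); rewrite subUset XA (subset_trans YD (subsetDl _ _)).
    move=> /(_ isT); rewrite cardsU disjoint_setI0 // cards0 subn0.
    rewrite bigcup_setU; move: (\bigcup_(x in X) N x) cX => Z cX.
    have -> : \bigcup_(x in Y) (N x :\: Z) = (\bigcup_(x in Y) N x) :\: Z.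
      apply/setP=> e; rewrite inE; apply/bigcupP/andP.
        case=> x xY; rewrite !inE => /andP[-> exN]; split=> //.
        by apply/bigcupP; exists x.
      by case=> eZ /bigcupP[x xY ex]; exists x; rewrite // !inE eZ.
    by rewrite cardsU cardsD setIC; lia.
  exists (fun x => if x \in X then f x else g x); split.
    have cross x y : x \in A -> y \in A -> x \in X -> y \notin X -> f x <> g y.
      move=> xA yA xX yX fg; have := gN y; rewrite !inE yA yX => /(_ isT).
      by case/andP=> /bigcupP[]; exists x => //; rewrite -fg fN.
    move=> x y xA yA; case: ifPn => xX; case: ifPn => yX.
    - exact: injf.
    - by move/(cross x y xA yA xX yX).
    - by move/esym/(cross y x yA xA yX xX).
    - by apply: injg; rewrite inE ?xX ?yX.
  move=> x xA /=; case: ifPn => xX; first exact: fN.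
  by have := gN x; rewrite !inE xA xX => /(_ isT)/andP[].
have [A0|[x xA]] := set_0Vmem A.
  by exists (fun=> e0); split=> x; rewrite A0 inE.
have [|[y yN]] := set_0Vmem (N x).
  move=> Nx0; have := hallA [set x]; rewrite sub1set xA big_set1 Nx0 cards1 cards0.
  by move=> /(_ isT).
have ltD : #|A :\ x| < k by rewrite (cardsD1 x A) xA in ltAk.
have [||f [injf fN]] := IHk (A :\ x) (fun z => N z :\ y) => //.
  move=> Y YA; have [->|/set0Pn/=Y0] := eqVneq Y set0; first by rewrite cards0.
  have YsA : Y \subset A := subset_trans YA (subsetDl _ _).
  have nYA : Y != A.
    by apply: contraTneq YA => ->; rewrite subsetD1 xA andbF.
  have Y0' : Y != set0 by apply/set0Pn.
  have -> : \bigcup_(z in Y) (N z :\ y) = (\bigcup_(z in Y) N z) :\ y.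
    apply/setP=> e; rewrite !inE; apply/bigcupP/andP.
      case=> z zY; rewrite !inE => /andP[-> ez]; split=> //.
      by apply/bigcupP; exists z.
    by case=> ey /bigcupP[z zY ez]; exists z; rewrite // !inE ey.
  move/existsPn: noX => /(_ Y); rewrite YsA Y0' nYA /= => nc.
  have := hallA Y YsA; rewrite leq_eqVlt eq_sym (negPf nc) /= => ltY.
  by have := cardsD1 y (\bigcup_(z in Y) N z); case: (y \in _) => /=; lia.
exists (fun z => if z == x then y else f z); split.
  have nfy z : z \in A -> z != x -> f z <> y.
    by move=> zA zx fz; have := fN z; rewrite !inE zA zx fz eqxx => /(_ isT).
  move=> a b aA bA; case: eqP => [->|/eqP ax]; case: eqP => [->|/eqP bx] //.
  - by move/esym/(nfy b bA bx).
  - by move/(nfy a aA ax).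
  - by apply: injf; rewrite !inE ?ax ?bx.
move=> z zA /=; case: eqP => [->//|/eqP zx].
by have := fN z; rewrite !inE zA zx => /(_ isT)/andP[].
Qed.

Section LocalHall.

Variables (V E : finType) (F : {set E}) (tips : E -> {set V}).

Definition touching (X : {set V}) := [set e in F | ~~ [disjoint tips e & X]].

Definition inside (W : {set V}) := [set e in F | tips e \subset W].

Fixpoint hop_ball (v : V) (t : nat) : {set V} :=
  if t is t'.+1
  then hop_ball v t' :|: \bigcup_(e in touching (hop_ball v t')) tips e
  else [set v].

Lemma hop_ball_leq v i j : i <= j -> hop_ball v i \subset hop_ball v j.
Proof.
move/subnK<-; elim: (j - i) => // k IHk.
exact: subset_trans IHk (subsetUl _ _).
Qed.

Lemma tips_hop_ball v t e :
  e \in touching (hop_ball v t) -> tips e \subset hop_ball v t.+1.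
Proof. by move=> et; rewrite /= subsetU // (bigcup_sup e) ?orbT. Qed.

Lemma hop_ball_sub v t (U : {set V}) :
  v \in U -> (forall e, e \in F -> tips e \subset U) -> hop_ball v t \subset U.
Proof.
move=> vU tU; elim: t => [|t IHt] /=; first by rewrite sub1set.
rewrite subUset IHt; apply/bigcupsP=> e; rewrite inE => /andP[eF _].
exact: tU.
Qed.

(** Double counting of incidences: only hyperedges touching [X] contribute, each at most [r]. The
    factor [b] expresses a degree of at least d/b without division. *)
Lemma leq_degree_touching (d b r : nat) (X : {set V}) :
  (forall x, x \in X -> d <= b * #|[set e in F | x \in tips e]|) ->
  (forall e, e \in F -> #|tips e| <= r) ->
  d * #|X| <= b * r * #|touching X|.
Proof.
move=> degX rankF.
have -> : d * #|X| = \sum_(x in X) d by rewrite sum_nat_const mulnC.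
apply: (@leq_trans (\sum_(x in X) b * #|[set e in F | x \in tips e]|)).
  exact: leq_sum.
rewrite -big_distrr -mulnA leq_mul2l /=; apply/orP; right.
have -> : \sum_(x in X) #|[set e in F | x \in tips e]| =
          \sum_(x in X) \sum_(e in F) (x \in tips e : nat).
  by apply: eq_bigr => x _; rewrite -sum1dep_card big_mkcondr.
rewrite exchange_big /= mulnC -sum_nat_const.
rewrite (bigID (fun e => [disjoint tips e & X])) /= big1 ?add0n.
  rewrite [leqRHS](eq_bigl (fun e => (e \in F) && ~~ [disjoint tips e & X])).
    apply: leq_sum => e /andP[eF _]; apply: leq_trans (rankF e eF).
    by rewrite -big_mkcondr sum1_card subset_leq_card //; apply/subsetP=> x /andP[].
  by move=> e; rewrite inE.
move=> e /andP[_ dis]; rewrite big1 // => x xX.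
by rewrite (disjointFl dis xX).
Qed.

(* The set [W] maximizes |inside W| - |W| among the subsets of the ball: removing
   vertices from it yields Hall's condition, and adding vertices to it shows
   that the part of the ball it misses grows geometrically. *)
Lemma local_hall (d b r t : nat) (v : V) :
  (forall x, x \in hop_ball v t -> d <= b * #|[set e in F | x \in tips e]|) ->
  (forall e, e \in F -> #|tips e| <= r) ->
  (b * r) ^ t * #|hop_ball v t| < d ^ t ->
  exists (W : {set V}) (f : V -> E),
    [/\ v \in W, W \subset hop_ball v t, {in W &, injective f} &
        {in W, forall x, [/\ f x \in F, x \in tips (f x) & tips (f x) \subset W]}].
Proof.
move=> degB rankF small.
pose B := hop_ball v t.
(* Adding [#|V|] keeps the difference to be maximized a natural number. *)
pose potential (W : {set V}) := #|inside W| + (#|V| - #|W|).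
have [W WB Wmax] : exists2 W : {set V}, W \subset B & forall W' : {set V},
    W' \subset B -> #|inside W'| + #|W| <= #|inside W| + #|W'|.
  case: (@arg_maxnP _ set0 (fun W : {set V} => W \subset B) potential).
    exact: sub0set.
  move=> W WB Wmax; exists W => // W' /Wmax; rewrite /potential.
  rewrite /geq /=.
  have := subset_leq_card (subsetT W); have := subset_leq_card (subsetT W'); rewrite cardsT.
  move: #|W| #|W'| #|V| #|inside W| #|inside W'| => w w' n i i'; lia.
have vW : v \in W.
  apply: contraTT small => vW; rewrite -leqNgt.
  have grow i : i <= t -> d ^ i <= (b * r) ^ i * #|hop_ball v i :\: W|.
    elim: i => [|i IHi] lt_it.
      rewrite mul1n expn0 card_gt0; apply/set0Pn; exists v.
      by rewrite !inE vW eqxx.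
    rewrite !expnS; apply: leq_trans (leq_mul (leqnn d) (IHi (ltnW lt_it))) _.
    rewrite mulnCA [b * r * _]mulnC -mulnA leq_mul2l; apply/orP; right.
    have deg x : x \in hop_ball v i :\: W -> d <= b * #|[set e in F | x \in tips e]|.
      rewrite inE => /andP[_ xB]; apply: degB.
      by apply: subsetP xB; apply/hop_ball_leq/ltnW.
    apply: leq_trans (leq_degree_touching deg rankF) _.
    rewrite leq_mul2l; apply/orP; right.
    set X := _ :\: _; set Y := _ :\: _.
    have YB : W :|: Y \subset B.
      rewrite subUset WB; apply: subset_trans (subsetDl _ _) _.
      exact: hop_ball_leq.
    have := Wmax _ YB.
    have -> : #|W :|: Y| = #|W| + #|Y|.
      by rewrite cardsU (_ : W :&: Y = set0) ?cards0 ?subn0 // /Y setDE setICA setICr setI0.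
    (* A hyperedge touching [X] is not inside [W], because [X] avoids [W]; and it is inside
       [W :|: Y], because its tips are at most one hop further. *)
    suff : #|inside W| + #|touching X| <= #|inside (W :|: Y)| by lia.
    rewrite -cardsUI (_ : inside W :&: touching X = set0) ?cards0 ?addn0.
      apply: subset_leq_card; rewrite subUset; apply/andP; split.
        apply/subsetP=> e; rewrite !inE => /andP[-> sub] /=.
        exact: subset_trans sub (subsetUl _ _).
      apply/subsetP=> e; rewrite !inE => /andP[eF tX]; rewrite eF /=.
      have eB : e \in touching (hop_ball v i).
        rewrite inE eF /=; apply: contraNN tX; rewrite disjoint_sym => dis.
        rewrite disjoint_sym; apply: disjointWl dis; exact: subsetDl.
      apply: subset_trans (tips_hop_ball eB) _.
      by apply/subsetP=> x xB; rewrite in_setU in_setD xB andbT orbN.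
    apply/setP=> e; rewrite !inE; apply/negP=> /andP[/andP[_ sub] /andP[_]].
    apply/negP; rewrite negbK; apply: disjointWl sub _.
    by rewrite disjoint_sym disjoints_subset subsetDr.
  apply: leq_trans (grow t (leqnn t)) _.
  by rewrite leq_mul2l subset_leq_card ?orbT ?subsetDl.
have [|[e0 _]] := set_0Vmem (inside W).
  move=> W0; have := Wmax set0 (sub0set B); rewrite W0 !cards0.
  rewrite addn0 => /(leq_trans (leq_addl _ _)); rewrite leqn0 cards_eq0.
  by move/eqP=> W00; rewrite W00 inE in vW.
pose N x := [set e in inside W | x \in tips e].
have [X XW|f [injf fN]] := @hall V E e0 W N.
  have := Wmax (W :\: X) (subset_trans (subsetDl _ _) WB).
  rewrite cardsD (setIidPr XW).
  have sub : inside W \subset inside (W :\: X) :|: \bigcup_(x in X) N x.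
    apply/subsetP=> e eW; rewrite inE; apply/orP.
    have [dis|/pred0Pn[x /andP[/= xe xX]]] := boolP [disjoint tips e & X].
      by left; move: eW; rewrite !inE subsetD dis andbT.
    by right; apply/bigcupP; exists x => //; rewrite inE eW.
  have := leq_trans (subset_leq_card sub) (leq_card_setU _ _).
  by have := subset_leq_card XW; lia.
exists W, f; split=> // x xW; have := fN x xW.
by rewrite !inE => /andP[/andP[-> ->] ->].
Qed.

End LocalHall.

(** * Independence and tail bounds for uniform coins *)

Section UniformProbability.

Variable R : realFieldType.
Local Open Scope ring_scope.

Definition prob (W : finType) (P : pred W) : R := #|P|%:R / #|W|%:R.

Lemma prob_ge0 (W : finType) (P : pred W) : 0 <= prob P.
Proof. by rewrite divr_ge0. Qed.

Lemma prob_le (W : finType) (P Q : pred W) :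
  (forall w, P w -> Q w) -> prob P <= prob Q.
Proof.
move=> PQ; rewrite ler_wpM2r ?invr_ge0 ?ler0n // ler_nat.
by apply: subset_leq_card; apply/subsetP=> w; apply: PQ.
Qed.

Lemma eq_prob (W : finType) (P Q : pred W) : P =1 Q -> prob P = prob Q.
Proof. by move=> PQ; rewrite /prob (eq_card PQ). Qed.

Lemma prob_pred0 (W : finType) : prob (@pred0 W) = 0.
Proof. by rewrite /prob card0 mul0r. Qed.

Lemma prob_le1 (W : finType) (P : pred W) : prob P <= 1.
Proof.
rewrite /prob; case: (posnP #|W|) => [->|W0]; first by rewrite invr0 mulr0.
by rewrite ler_pdivrMr ?ltr0n // mul1r ler_nat max_card.
Qed.

Lemma prob_predC (W : finType) (P : pred W) :
  (0 < #|W|)%N -> prob (predC P) = 1 - prob P.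
Proof.
move=> W0; have W0' : #|W|%:R != 0 :> R by rewrite pnatr_eq0 -lt0n.
by apply/eqP; rewrite eq_sym subr_eq -mulrDl -natrD addnC cardC divff.
Qed.

Lemma prob_predU (W : finType) (P Q : pred W) :
  prob (predU P Q) <= prob P + prob Q.
Proof.
rewrite -mulrDl -natrD ler_wpM2r ?invr_ge0 ?ler0n // ler_nat.
by rewrite -cardUI leq_addr.
Qed.

Lemma prob_exists (W I : finType) (P : I -> pred W) :
  prob (fun w => [exists i, P i w]) <= \sum_i prob (P i).
Proof.
rewrite -mulr_suml -natr_sum ler_wpM2r ?invr_ge0 ?ler0n // ler_nat.
rewrite -sum1_card; under [leqRHS]eq_bigr do rewrite -sum1_card big_mkcond.
rewrite exchange_big /= big_mkcond leq_sum // => w _.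
case: ifP => // /existsP[i iP]; rewrite (bigD1 i) //= ifT //.
Qed.

Section Product.

Variables T S : finType.
Implicit Types (D : {set T}) (P Q : pred {ffun T -> S}).

Definition depends_on D P :=
  forall f g : {ffun T -> S}, {in D, f =1 g} -> P f = P g.

(* Swapping the coordinates outside D is an involution on pairs of outcomes
   that maps (P and Q) x everything onto P x Q. *)
Lemma prob_indep D P Q : depends_on D P -> depends_on (~: D) Q ->
  prob (predI P Q) = prob P * prob Q.
Proof.
move=> dP dQ; pose mix (f g : {ffun T -> S}) := [ffun x => if x \in D then f x else g x].
pose swap (w : {ffun T -> S} * {ffun T -> S}) := (mix w.1 w.2, mix w.2 w.1).
have swapK : involutive swap.
  move=> [f g]; congr pair; apply/ffunP=> x; rewrite !ffunE /=; by case: (x \in D).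
have Pmix f g : P (mix f g) = P f by apply: dP => x xD; rewrite ffunE xD.
have Qmix f g : Q (mix f g) = Q g.
  by apply: dQ => x xD; rewrite ffunE; move: xD; rewrite inE => /negPf->.
have card_eq : (#|predI P Q| * #|{: {ffun T -> S}}| = #|P| * #|Q|)%N.
  have -> : (#|predI P Q| * #|{: {ffun T -> S}}|)%N =
      #|[pred w : {ffun T -> S} * {ffun T -> S} | P w.1 && Q w.1]|.
    rewrite -(cardX (predI P Q) predT); apply: eq_card => w.
    by rewrite !inE /= andbT.
  rewrite -cardX -(card_image (inv_inj swapK)); apply: eq_card => w.
  rewrite -{1}(swapK w) mem_image; last exact: inv_inj.
  by case: w => f g; rewrite !inE /= Pmix Qmix.
have [W0|W0] := posnP #|{: {ffun T -> S}}|.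
  by rewrite /prob W0 invr0 !mulr0.
rewrite /prob mulrACA -natrM -card_eq natrM -mulrA; congr (_ * _).
by rewrite mulrA divff ?mul1r // pnatr_eq0 -lt0n.
Qed.

Lemma prob_all_indep (V : eqType) (dep : V -> {set T})
    (bad : V -> pred {ffun T -> S}) (p : R) (s : seq V) :
  (forall v, depends_on (dep v) (bad v)) -> (forall v, prob (bad v) <= p) ->
  pairwise (fun u v => [disjoint dep u & dep v]) s ->
  prob (fun f => all (fun v => bad v f) s) <= p ^+ size s.
Proof.
move=> dbad pbad; elim: s => [_|v s IHs] /=; first exact: prob_le1.
move=> /andP[/allP vs /IHs{}IHs].
have ds : depends_on (~: dep v) (fun f => all (fun u => bad u f) s).
  move=> f g fg; apply: eq_in_all => u /vs dis; apply: dbad => x xu.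
  by apply: fg; rewrite inE (disjointFl dis xu).
have -> : prob (fun f => bad v f && all (fun u => bad u f) s) =
  prob (bad v) * prob (fun f => all (fun u => bad u f) s) := prob_indep (dbad v) ds.
by rewrite exprS ler_pM ?prob_ge0.
Qed.

(** Chernoff's method: the right-hand side is the expectation of x^count, and x^count >= x^m on the
    event. The factor [x ^+ m] is not divided out, so that x = 0, m = 0 gives the probability of no
    hit at all. *)
Lemma prob_count_le (J : {set T}) (Q : T -> pred S) (x q : R) (m : nat) :
  (0 < #|S|)%N -> 0 <= x <= 1 ->
  (forall j, j \in J -> #|Q j|%:R = q * #|S|%:R) ->
  prob (fun f : {ffun T -> S} => (#|[set j in J | Q j (f j)]| <= m)%N) * x ^+ m
    <= (1 - q * (1 - x)) ^+ #|J|.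
Proof.
move=> S0 /andP[x0 x1] Qq.
have S0' : #|S|%:R != 0 :> R by rewrite pnatr_eq0 -lt0n.
pose w (f : {ffun T -> S}) : R := x ^+ #|[set j in J | Q j (f j)]|.
have -> : (1 - q * (1 - x)) ^+ #|J| = (\sum_f w f) / #|{: {ffun T -> S}}|%:R.
  have wE f : w f = \prod_j (if (j \in J) && Q j (f j) then x else 1).
    by rewrite -big_mkcond prodr_const; congr (_ ^+ _); apply: eq_card => j; rewrite inE.
  rewrite (eq_bigr _ (fun f _ => wE f)) -(bigA_distr_bigA (fun j s => if (j \in J) && Q j s then x else 1)).
  rewrite card_ffun natrX -[X in _ / X]prodr_const -prodf_div.
  rewrite [RHS](bigID (mem J)) /=.
  rewrite [X in _ = _ * X]big1 ?mulr1 => [|j /negPf jJ].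
    rewrite -prodr_const; apply: eq_bigr => j jJ.
    under eq_bigr do rewrite jJ /=.
    rewrite (bigID (Q j)) /= (eq_bigr (fun=> x)) => [|s ->//].
    rewrite [X in (_ + X) / _](eq_bigr (fun=> 1)) => [|s /negPf->//].
    rewrite !sumr_const.
    have cQ : #|predC (Q j)|%:R = #|S|%:R - #|Q j|%:R :> R.
      by rewrite -(cardC (Q j)) natrD addrC addKr.
    rewrite -[x *+ _]mulr_natr cQ Qq //; apply: (mulIf S0').
    by rewrite mulfVK //; ring.
  under eq_bigr do rewrite jJ /=.
  by rewrite sumr_const divff.
rewrite mulrAC ler_wpM2r ?invr_ge0 ?ler0n //.
rewrite -sum1_card natr_sum mulr_suml big_mkcond /=.
apply: ler_sum => f _; case: ifP => [/=|_]; last by rewrite exprn_ge0.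
by move=> le_m; rewrite mul1r ler_wiXn2l.
Qed.

End Product.

End UniformProbability.

(** * Separated subsets of connected sets *)

Section Walks.

Variables (V : Type) (L : Type) (nb : V -> L -> V).

(* A word encodes a depth-first traversal of a tree: [Some l] moves from the
   current vertex [u] to the new vertex [nb u l], and [None] backtracks. *)
Fixpoint visited (u : V) (stack : seq V) (w : seq (option L)) : seq V :=
  match w with
  | [::] => [::]
  | Some l :: w' => nb u l :: visited (nb u l) (u :: stack) w'
  | None :: w' =>
      if stack is u' :: stack' then visited u' stack' w' else visited u [::] w'
  end.

Lemma size_visited u stack w : size (visited u stack w) = count isSome w.
Proof. by elim: w u stack => [//|[l|] w IHw] u [|u' stack] //=; rewrite IHw. Qed.

End Walks.

(** When the traversal stands at [x], the detour [Some l], [None] visits the new vertex and restores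
    both the current vertex and the stack, so the rest of the word is read as before. *)
Lemma visited_insert (V : eqType) (L : Type) (nb : V -> L -> V) u stack w x l :
  x \in u :: visited nb u stack w ->
  exists w', [/\ size w' = (size w).+2, count isSome w' = (count isSome w).+1 &
    perm_eq (visited nb u stack w') (nb x l :: visited nb u stack w)].
Proof.
elim: w u stack => [|o w IHw] u stack.
  by rewrite mem_seq1 => /eqP->; exists [:: Some l; None].
rewrite inE; have [-> _|xu /= xw] := eqVneq x u.
  by exists (Some l :: None :: o :: w).
case: o xw => [m|] xw.
  have [w' [sw' cw' pw']] := IHw _ _ xw.
  exists (Some m :: w'); split; rewrite /= ?sw' ?cw' //.
  apply: (@perm_trans _ (nb u m :: nb x l :: visited nb (nb u m) (u :: stack) w)).
    by rewrite perm_cons.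
  by rewrite -[_ :: _ :: _]/([:: _] ++ [:: _] ++ _) perm_catCA.
have {}IHw u' stack' : x \in visited nb u' stack' w -> exists w',
    [/\ size w' = (size w).+2, count isSome w' = (count isSome w).+1 &
    perm_eq (visited nb u' stack' w') (nb x l :: visited nb u' stack' w)].
  by move=> xw'; apply: IHw; rewrite inE xw' orbT.
case: stack xw => [|u' stack] /= /IHw[w' [sw' cw' pw']];
  by exists (None :: w'); rewrite /= sw' cw'.
Qed.

Lemma card_words (L : finType) (s : nat) : 0 < #|L| ->
  #|[set w : (2 * s).-tuple (option L) | count isSome w == s]| <= (4 * #|L|) ^ s.
Proof.
case/card_gt0P=> l0 _.
(* A word is determined by its shape, [2 * s] bits, and its list of labels. The words counted have
   exactly [s] labels, so the default tuple never occurs on them. *)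
pose code (w : (2 * s).-tuple (option L)) :=
  (map_tuple isSome w, insubd (nseq_tuple s l0) (pmap id w)).
have <- : #|{: (2 * s).-tuple bool * s.-tuple L}| = (4 * #|L|) ^ s.
  by rewrite card_prod !card_tuple card_bool expnM expnMn.
rewrite -(@card_in_imset _ _ code) ?max_card // => w w'.
rewrite !inE => /eqP cw /eqP cw' [eqb eql].
have {}eql : pmap id w = pmap id w'.
  have sp v : count isSome (v : seq (option L)) = s -> size (pmap id v) == s.
    by move=> <-; rewrite size_pmap.
  by have := congr1 val eql; rewrite !val_insubd !sp.
apply: val_inj => /=; elim: (val w) (val w') eqb eql => [|[a|] v IHv] [|[b|] v'] //=.
  by case=> eqb [-> eql]; rewrite (IHv v').
by case=> eqb eql; rewrite (IHv v').
Qed.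

Lemma perm_pairwise (T : eqType) (r : rel T) (s1 s2 : seq T) :
  symmetric r -> perm_eq s1 s2 -> pairwise r s1 -> pairwise r s2.
Proof.
move=> r_sym perm; move: s1 s2 perm; apply: catCA_perm_ind => u1 u2 u3.
rewrite !pairwise_cat !allrel_catr => /and3P[/andP[r12 r13] r1 /and3P[r23 r2 r3]].
have -> : allrel r u2 u1 by rewrite allrelC (eq_allrel (r' := r)) // => x y; rewrite r_sym.
by apply/and5P; split.
Qed.

Section Separation.

Variables (V T : finType) (adj : rel V) (dep : V -> {set T}) (Delta : nat).
Hypothesis adj_refl : reflexive adj.
Hypothesis degree_adj : forall u, #|[set v | adj u v]| <= Delta.

Fixpoint near (k : nat) (u : V) : {set V} :=
  if k is k'.+1 then \bigcup_(w in near k' u) [set v | adj w v] else [set u].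

Lemma near_center k u : u \in near k u.
Proof.
by elim: k => [|k IHk] /=; [rewrite inE | apply/bigcupP; exists u; rewrite ?inE].
Qed.

Lemma card_near k u : #|near k u| <= Delta ^ k.
Proof.
elim: k => [|k IHk]; rewrite ?cards1 //= expnS mulnC.
apply: leq_trans (leq_mul IHk (leqnn Delta)).
rewrite -sum_nat_const; elim/big_rec2: _ => [|w n A _ le_An]; first by rewrite cards0.
by apply: leq_trans (leq_card_setU _ _) _; rewrite leq_add.
Qed.

(** A common alphabet for the moves from all vertices; labels past the end of the enumeration stay
    at [u]. *)
Definition step4 (u : V) (l : 'I_(Delta ^ 4)) : V := nth u (enum (near 4 u)) l.

Lemma step4_near u v : v \in near 4 u -> exists l, v = step4 u l.
Proof.
move=> uv; have lt_l : index v (enum (near 4 u)) < Delta ^ 4.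
  by rewrite (leq_trans _ (card_near 4 u)) // cardE index_mem mem_enum.
by exists (Ordinal lt_l); rewrite /step4 nth_index // mem_enum.
Qed.

Hypothesis dep_near : forall u v, ~~ [disjoint dep u & dep v] -> v \in near 3 u.

(* Among the vertices that are not within three steps of those found so far,
   one that comes first in the order of the balls is within four steps. *)
Lemma separated_walk (B : nat -> {set V}) (v : V) (t s : nat) :
  B 0 = [set v] ->
  (forall i x, x \in B i.+1 -> x \in B i \/ exists2 z, z \in B i & adj z x) ->
  (forall i, i <= t -> B i \subset B t) ->
  s * Delta ^ 3 < #|B t| ->
  exists w : seq (option 'I_(Delta ^ 4)),
    [/\ size w = 2 * s, count isSome w = s,
        {subset v :: visited step4 v [::] w <= B t} &
        pairwise (fun x y => [disjoint dep x & dep y]) (v :: visited step4 v [::] w)].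
Proof.
move=> B0 Bstep Bsub; elim: s => [|s IHs] big.
  exists [::]; split=> // x; rewrite inE => /eqP->.
  by apply: (subsetP (Bsub 0 (leq0n t))); rewrite B0 inE.
have [|w [sw cw wB pw]] := IHs.
  by apply: leq_ltn_trans big; rewrite leq_mul2r leqnSn orbT.
set S := _ :: _ in wB pw.
pose N := \bigcup_(x in [set x in S]) near 3 x.
have memN x y : x \in S -> y \in near 3 x -> y \in N.
  by move=> xS yx; apply/bigcupP; exists x => //; rewrite inE.
(* The [s.+1] vertices found so far exclude at most [s.+1 * Delta ^ 3] vertices, fewer than the ball
   contains. *)
have [x xB xN] : exists2 x, x \in B t & x \notin N.
  apply/subsetPn; apply: contraTN big => /subset_leq_card le_BN.
  rewrite -leqNgt; apply: leq_trans le_BN _.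
  have leS : #|[set x in S]| <= s.+1.
    by rewrite cardsE (leq_trans (card_size S)) //= size_visited cw.
  apply: leq_trans (leq_mul leS (leqnn _)).
  rewrite -sum_nat_const /N; elim/big_rec2: _ => [|z n A _ le_An].
    by rewrite cards0.
  by apply: leq_trans (leq_card_setU _ _) _; rewrite leq_add ?card_near.
have [y [z [yB yN zS yz]]] : exists y z,
    [/\ y \in B t, y \notin N, z \in S & y \in near 4 z].
  have : forall i, i <= t -> ~~ (B i \subset N) -> exists y z,
      [/\ y \in B t, y \notin N, z \in S & y \in near 4 z].
    elim=> [_|i IHi lt_it] /subsetPn[y yB yN].
      case/negP: yN; move: yB; rewrite B0 inE => /eqP->.
      by apply: (memN v); rewrite ?inE ?eqxx // near_center.
    have [yBi|[z zB zy]] := Bstep i y yB.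
      by apply: IHi (ltnW lt_it) _; apply/subsetPn; exists y.
    have [zN|zN] := boolP (z \in N); last first.
      by apply: IHi (ltnW lt_it) _; apply/subsetPn; exists z.
    have /bigcupP[a] := zN; rewrite inE => aS za.
    exists y, a; split=> //; first by apply: (subsetP (Bsub i.+1 lt_it)).
    by apply/bigcupP; exists z; rewrite ?inE.
  by apply; [exact: leqnn | apply/subsetPn; exists x].
have [l yl] := step4_near yz.
have [w' [sw' cw' pw']] := visited_insert l zS.
exists w'; split; rewrite ?sw' ?cw' ?sw ?cw //; first by rewrite mulnS.
  move=> a; rewrite in_cons (perm_mem pw') in_cons -yl => /or3P[/eqP->|/eqP->//|aw].
    by apply: wB; rewrite in_cons eqxx.
  by apply: wB; rewrite in_cons aw orbT.
have dis_sym : symmetric (fun x y => [disjoint dep x & dep y]).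
  by move=> a b; rewrite disjoint_sym.
have perm : perm_eq (v :: visited step4 v [::] w') (y :: S).
  apply: (@perm_trans _ (v :: y :: visited step4 v [::] w)).
    by rewrite perm_cons yl.
  by rewrite -[_ :: _ :: _]/([:: _] ++ [:: _] ++ _) perm_catCA.
rewrite perm_sym in perm; apply: perm_pairwise dis_sym perm _.
rewrite pairwise_cons pw andbT.
apply/allP=> a aS; rewrite disjoint_sym; apply: contraNT yN => /dep_near.
exact: memN.
Qed.

End Separation.

(** * Shattering *)

Section Shattering.

Variable R : realFieldType.
Variables (V E : finType) (inc : V -> {set E}) (pos : V -> E -> nat) (r d : nat).

Implicit Types (j : {ffun E -> 'I_(2 * r)}) (u v : V) (e : E).

(* Half of the values of the seed of [e] make it inactive, and each of the others
   selects the position of the vertex that it tries to satisfy. *)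
Definition bad j v := 8 * #|[set e in inc v | r <= j e]| < d.

Definition live j e := (j e < r) && [forall v, (e \in inc v) ==> ~~ bad j v].

Definition sat j v := [exists e, [&& e \in inc v, j e == pos v e :> nat & live j e]].

Definition free j := [set e | ~~ live j e].

Definition unsat_tips j e := [set v | (e \in inc v) && ~~ sat j v].

(** The threshold is the one of [separated_walk]: a larger ball contains [s.+1] unsatisfied vertices
    with disjoint sets of relevant coins. *)
Definition small_balls (s t : nat) j :=
  [forall v, sat j v ||
    (#|hop_ball (free j) (unsat_tips j) v t| <= s * (d * r) ^ 3)].

Hypothesis deg_inc : forall v, #|inc v| = d.
Hypothesis rank_inc : forall e, #|[set v | e \in inc v]| <= r.
Hypothesis pos_lt : forall v e, e \in inc v -> pos v e < r.
Hypothesis d_gt0 : 0 < d.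
Hypothesis r_gt0 : 0 < r.

(** At a bad vertex no hyperedge is live, so all [d] are free. At any other vertex at least d/8
    hyperedges are inactive, hence free. *)
Lemma free_degree j v : ~~ sat j v ->
  d <= 8 * #|[set e in free j | v \in unsat_tips j e]|.
Proof.
move=> vU; have [vbad|] := boolP (bad j v).
  apply: (@leq_trans (8 * #|inc v|)); first by rewrite deg_inc leq_pmull.
  rewrite leq_mul2l /= subset_leq_card //; apply/subsetP=> e ve.
  rewrite !inE ve vU /= andbT /live; apply/nandP; right; apply/forallPn; exists v.
  by rewrite ve vbad.
rewrite /bad -leqNgt => /leq_trans-> //.
rewrite leq_mul2l /= subset_leq_card //; apply/subsetP=> e.
by rewrite !inE => /andP[ve je]; rewrite ve vU /live ltnNge je.
Qed.

Lemma small_balls_hall (s t : nat) j v :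
  small_balls s t j -> (8 * r) ^ t * (s * (d * r) ^ 3) < d ^ t -> ~~ sat j v ->
  exists (W : {set V}) (f : V -> E),
    [/\ v \in W, W \subset hop_ball (free j) (unsat_tips j) v t,
        {in W &, injective f} &
        {in W, forall x, [/\ f x \in free j, x \in unsat_tips j (f x) &
                             unsat_tips j (f x) \subset W]}].
Proof.
move=> /forallP/(_ v) sb big vU; rewrite (negPf vU) /= in sb.
apply: (@local_hall _ _ _ _ d 8 r).
- move=> x xB; apply: free_degree; pose U := [set x | ~~ sat j x].
  have /subsetP : hop_ball (free j) (unsat_tips j) v t \subset U.
    apply: hop_ball_sub; first by rewrite inE.
    by move=> e _; apply/subsetP=> u; rewrite !inE => /andP[].
  by move/(_ x xB); rewrite inE.
- move=> e _; apply: leq_trans (rank_inc e); apply: subset_leq_card.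
  by apply/subsetP=> u; rewrite !inE => /andP[].
- by apply: leq_ltn_trans big; rewrite leq_mul2l sb orbT.
Qed.

Definition share u v := [exists e, (e \in inc u) && (e \in inc v)].

(** The coins that decide whether [v] is satisfied: liveness of a hyperedge of [v] involves [bad] at
    each of its vertices, hence all coins around these. *)
Definition dep v : {set E} := \bigcup_(u in [set u | share v u]) inc u.

Lemma shareC : symmetric share.
Proof. by move=> u v; apply: eq_existsb => e; rewrite andbC. Qed.

Lemma share_refl : reflexive share.
Proof.
move=> v; have /card_gt0P[e ev] : 0 < #|inc v| by rewrite deg_inc.
by apply/existsP; exists e; rewrite ev.
Qed.

Lemma degree_share v : #|[set u | share v u]| <= d * r.
Proof.
rewrite -(deg_inc v) -sum_nat_const.
apply: (@leq_trans #|\bigcup_(e in inc v) [set u | e \in inc u]|).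
  apply: subset_leq_card; apply/subsetP=> u; rewrite inE => /existsP[e /andP[ve ue]].
  by apply/bigcupP; exists e; rewrite ?inE.
elim/big_rec2: _ => [|e n A _ le_An]; first by rewrite cards0.
by apply: leq_trans (leq_card_setU _ _) _; rewrite leq_add.
Qed.

Lemma inc_sub_dep u v : share v u -> inc u \subset dep v.
Proof. by move=> vu; apply: bigcup_sup; rewrite inE. Qed.

(** A common coin belongs to a vertex [w] sharing a hyperedge with [u] and to a vertex [w'] sharing
    one with [v]; the three links are u-w, w-w' and w'-v. *)
Lemma dep_near_share u v : ~~ [disjoint dep u & dep v] -> v \in near share 3 u.
Proof.
case/pred0Pn=> e /andP[/= /bigcupP[w]]; rewrite inE => uw we /bigcupP[w'].
rewrite inE => vw' we'; apply/bigcupP; exists w'; last by rewrite inE shareC.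
apply/bigcupP; exists w; last by rewrite inE; apply/existsP; exists e; rewrite we.
by apply/bigcupP; exists u; rewrite inE.
Qed.

Lemma unsat_depends v : depends_on (dep v) (fun j => ~~ sat j v).
Proof.
move=> f g fg; congr (~~ _); apply: eq_existsb => e.
have [ve|//] := boolP (e \in inc v); rewrite /=.
have eqj u e' : e' \in inc u -> share v u -> f e' = g e'.
  by move=> ue' vu; apply: fg; apply: (subsetP (inc_sub_dep vu)).
have eqbad u : share v u -> bad f u = bad g u.
  move=> vu; rewrite /bad; congr (8 * _ < d); apply: eq_card => e'; rewrite !inE.
  by have [ue'|//] := boolP (e' \in inc u); rewrite (eqj u).
rewrite /live (eqj v e ve (share_refl v)); congr [&& _, _ & _].
apply: eq_forallb => u; have [ue|//] := boolP (e \in inc u); rewrite /= eqbad //.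
by apply/existsP; exists e; rewrite ve.
Qed.

Local Open Scope ring_scope.

Lemma prob_unchosen v :
  prob R (fun j => #|[set e in inc v | j e == pos v e :> nat]| == 0%N)
    <= (1 - (2 * r)%:R^-1) ^+ d.
Proof.
rewrite -[X in _ ^+ X](deg_inc v).
have := @prob_count_le R E 'I_(2 * r) (inc v) (fun e i => i == pos v e :> nat)
  0 (2 * r)%:R^-1 0.
rewrite card_ord muln_gt0 r_gt0 lexx ler01 expr0 mulr1 subr0 mulr1.
have -> : prob R (fun j => #|[set e in inc v | j e == pos v e :> nat]| <= 0)%N =
  prob R (fun j => #|[set e in inc v | j e == pos v e :> nat]| == 0%N).
  by apply: eq_prob => j; rewrite leqn0.
apply=> // e ve; rewrite mulVf ?pnatr_eq0 -?lt0n ?muln_gt0 ?r_gt0 //.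
have lt_p : (pos v e < 2 * r)%N by rewrite mul2n -addnn ltn_addr // pos_lt.
rewrite -[RHS]/(1%:R); congr (_%:R).
by rewrite -[RHS](card1 (Ordinal lt_p)); apply: eq_card => i; rewrite !inE.
Qed.

(** [prob_count_le] with hit probability 1/2 and x = 1/16 gives 16^m (17/32)^d with m at most d/8.
    Since 16^(2m) <= 2^d, the square of this is at most (289/512)^d; working with squares avoids the
    square root of 2. *)
Lemma prob_bad v (eps : R) :
  0 <= eps -> (289%:R / 512%:R) ^+ d <= eps ^+ 2 -> prob R (bad^~ v) <= eps.
Proof.
move=> eps0 small.
pose m := (d.-1 %/ 8)%N.
have badE j : bad j v = (#|[set e in inc v | r <= j e]| <= m)%N.
  by rewrite /bad /m; case: d d_gt0 => // d' _; rewrite leq_divRL // mulnC.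
rewrite (eq_prob _ badE).
have := @prob_count_le R E 'I_(2 * r) (inc v) (fun e i => r <= i)%N
  (16%:R^-1) (2%:R^-1) m.
set P := prob _ _; rewrite card_ord muln_gt0 r_gt0 deg_inc.
have -> : (1 - 2^-1 * (1 - 16^-1) : R) = 17%:R / 32%:R by field.
move=> /(_ isT) H.
have {H} le_P : P * 16^-1 ^+ m <= (17%:R / 32%:R) ^+ d.
  apply: H => [|e _]; first by lra.
  have -> : #|(fun i : 'I_(2 * r) => r <= i)%N| = r.
    rewrite -sum1_card big_mkcond /= -(big_mkord xpredT (fun i => if (r <= i)%N then 1%N else 0%N)).
    rewrite (big_cat_nat _ (n := r)) //=; last by rewrite leq_pmull.
    rewrite big_nat_cond big1 ?add0n; last first.
      by move=> i; rewrite andbT ltnNge => /andP[_ /negPf->].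
    rewrite (eq_big_nat _ _ (F2 := fun=> 1%N)); last by move=> i /andP[->].
    by rewrite sum_nat_const_nat muln1 mul2n -addnn addnK.
  by rewrite natrM mulrA mulVf ?mul1r // pnatr_eq0.
have P0 : 0 <= P by exact: prob_ge0.
rewrite -(ler_pXn2r (n := 2)) ?nnegrE //; apply: le_trans small.
have -> : 289%:R / 512%:R = 2%:R * (17%:R / 32%:R) ^+ 2 :> R by field.
rewrite (exprMn d) -exprM (mulnC 2%N d) exprM.
have {}le_P : P <= 16%:R ^+ m * (17%:R / 32%:R) ^+ d.
  by rewrite mulrC -ler_pdivrMr ?exprn_gt0 // -exprVn.
apply: (@le_trans _ _ ((16%:R ^+ m * (17%:R / 32%:R) ^+ d) ^+ 2)).
  by rewrite ler_pXn2r ?nnegrE // mulr_ge0 ?exprn_ge0 // divr_ge0.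
rewrite exprMn ler_wpM2r ?sqr_ge0 //.
rewrite -exprM (_ : 16 = 2 ^+ 4 :> R); last by ring.
rewrite -exprM ler_eXn2l ?ltr1n // /m.
by case: d d_gt0 => // d' _; have := leq_trunc_div d' 8; lia.
Qed.

(** If some hyperedge selects [v] and no vertex sharing a hyperedge with [v] is bad, that hyperedge
    is live and satisfies [v]. The first failure accounts for the [1] in [(d * r).+1], the second
    for a union bound over [d * r] vertices. *)
Lemma prob_unsat v (eps : R) : 0 <= eps ->
  (1 - (2 * r)%:R^-1) ^+ d <= eps -> (289%:R / 512%:R) ^+ d <= eps ^+ 2 ->
  prob R (fun j => ~~ sat j v) <= (d * r).+1%:R * eps.
Proof.
move=> eps0 le1 le2.
pose A (j : {ffun E -> 'I_(2 * r)}) := #|[set e in inc v | j e == pos v e :> nat]| == 0%N.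
pose B u (j : {ffun E -> 'I_(2 * r)}) := share v u && bad j u.
have sub j : ~~ sat j v -> A j || [exists u, B u j].
  move/existsPn=> nsat; apply/norP=> -[/eqP/eqP]; rewrite -lt0n.
  case/card_gt0P=> e; rewrite inE => /andP[ve jp] /existsPn nbad.
  have /negP := nsat e; apply; rewrite ve jp /live (eqP jp) pos_lt //=.
  apply/forallP=> u; apply/implyP=> ue; have := nbad u; rewrite /B negb_and.
  by case/orP=> // /existsPn/(_ e); rewrite ve ue.
apply: (le_trans (prob_le R sub)).
apply: (le_trans (prob_predU _ A (fun j => [exists u, B u j]))).
rewrite -[(d * r).+1]add1n natrD mulrDl mul1r; apply: lerD.
  exact: le_trans (prob_unchosen v) le1.
apply: (le_trans (prob_exists R B)).
apply: (@le_trans _ _ (\sum_(u in [set u | share v u]) eps)).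
  rewrite [leRHS]big_mkcond /=; apply: ler_sum => u _; rewrite inE /B.
  by case: (share v u); [exact: prob_bad | rewrite prob_pred0].
by rewrite sumr_const -[leLHS]mulr_natl ler_wpM2r // ler_nat degree_share.
Qed.

Lemma prob_large_ball (s t : nat) (p : R) : 0 <= p ->
  (forall v, prob R (fun j => ~~ sat j v) <= p) ->
  prob R (fun j => ~~ small_balls s t j) <=
    #|V|%:R * (4 * (d * r) ^ 4)%:R ^+ s * p ^+ s.+1.
Proof.
move=> p0 unsat_p.
pose L := 'I_((d * r) ^ 4); pose nb := @step4 V share (d * r).
pose W := (2 * s).-tuple (option L).
pose walk (v : V) (w : seq (option L)) := v :: visited nb v [::] w.
(* [good] does not involve the coins, so a pair that violates it has an impossible event [A]; only
   words with [s] forward moves are charged in the sum. *)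
pose good (vw : V * W) := (count isSome vw.2 == s) &&
  pairwise (fun x y => [disjoint dep x & dep y]) (walk vw.1 vw.2).
pose A (vw : V * W) j := good vw && all (fun x => ~~ sat j x) (walk vw.1 vw.2).
have sub j : ~~ small_balls s t j -> [exists vw, A vw j].
  case/forallPn=> v; rewrite negb_or -ltnNge => /andP[vU big].
  set F := free j in big; set tips := unsat_tips j in big.
  have tipsU e : e \in F -> tips e \subset [set x | ~~ sat j x].
    by move=> _; apply/subsetP=> u; rewrite !inE => /andP[].
  have [||w [sw cw wB pw]] := separated_walk share_refl degree_share dep_near_share
     (B := hop_ball F tips v) (v := v) (t := t) (s := s) (erefl _) _ _ big.
  - move=> i x /=; rewrite inE => /orP[|/bigcupP[e]]; first by left.
    rewrite inE => /andP[_ /pred0Pn[z /andP[/= ze zB]]] xe; right; exists z => //.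
    apply/existsP; exists e; move: ze xe; rewrite !inE.
    by move=> /andP[-> _] /andP[-> _].
  - by move=> i; apply: hop_ball_leq.
  have sw' : size w == (2 * s)%N by rewrite sw.
  apply/existsP; exists (v, Tuple sw'); rewrite /A /good cw eqxx pw /=.
  have BU : hop_ball F tips v t \subset [set x | ~~ sat j x].
    by apply: hop_ball_sub; rewrite // inE.
  rewrite vU; apply/allP=> x xw.
  have /wB/(subsetP BU) : x \in v :: visited nb v [::] w by rewrite in_cons xw orbT.
  by rewrite inE.
apply: (le_trans (prob_le R sub)); apply: (le_trans (prob_exists R A)).
have pA vw : prob R (A vw) <= (count isSome vw.2 == s)%:R * p ^+ s.+1.
  have [|ngood] := boolP (good vw); last first.
    rewrite (eq_prob R (Q := pred0)) ?prob_pred0 ?mulr_ge0 ?ler0n ?exprn_ge0 //.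
    by move=> j; rewrite /A (negPf ngood).
  move=> gvw; case/andP: (gvw) => /eqP cvw pvw; rewrite cvw eqxx mul1r.
  rewrite (eq_prob R (Q := fun j => all (fun x => ~~ sat j x) (walk vw.1 vw.2))).
    have <- : size (walk vw.1 vw.2) = s.+1 by rewrite /= size_visited cvw.
    apply: (prob_all_indep (bad := fun x j => ~~ sat j x) unsat_depends) => //.
  by move=> j; rewrite /A gvw.
apply: (le_trans (ler_sum _ (fun vw _ => pA vw))).
rewrite -mulr_suml ler_wpM2r ?exprn_ge0 // /=.
rewrite -(pair_bigA _ (fun (v : V) (w : W) => (count isSome w == s)%:R)) /=.
rewrite sumr_const -[leLHS]mulr_natl ler_wpM2l ?ler0n //.
rewrite -natrX -natr_sum ler_nat -[X in (4 * X)%N]card_ord.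
rewrite -big_mkcond sum1dep_card; apply: card_words.
by rewrite card_ord expn_gt0 muln_gt0 d_gt0 r_gt0.
Qed.

End Shattering.

(** * Functions of the nodes computable in a given number of rounds *)

Section LocalFunctionals.

Variable S : finType.

Record env := Env {
  graph : hypergraph;
  ident : bip_node graph -> nat;
  coins : {ffun bip_node graph -> S}
}.

Definition nbrs (G : env) (x : bip_node (graph G)) : seq (bip_node (graph G)) :=
  neighbours (@bip_adj (graph G)) (@ident G) x.

Inductive knowledge :=
  | Own of bool & nat & nat & S
  | Learn of knowledge & seq (nat * knowledge).

Fixpoint info (T : nat) (G : env) (x : bip_node (graph G)) : knowledge :=
  if T is T'.+1
  then Learn (info T' x) [seq (ident y, info T' y) | y <- nbrs x]
  else Own (is_vertex x) (ident x) (size (nbrs x)) (coins G x).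

Definition full_info (T : nat) (phi : knowledge -> nat) : local_algorithm bool nat :=
  @LocalAlgorithm bool nat knowledge knowledge S T
    Own (fun st _ => st) Learn phi.

Lemma execute_full_info T phi (G : env) (x : bip_node (graph G)) :
  execute (A := full_info T phi) (@bip_adj (graph G)) (@is_vertex (graph G))
    (@ident G) (coins G) x = phi (info T x).
Proof.
rewrite /execute /=; congr phi.
elim: T x => [//|k IHk] x; rewrite iterS /round IHk /=.
by congr Learn; apply: eq_map => y; rewrite IHk.
Qed.

(** One [phi] serves all hypergraphs, identifiers and coins, which makes it the output map of a
    genuine algorithm; it is kept as a witness to be extracted for [full_info]. *)
Definition local (T : nat) (X : Type) (F : forall G : env, bip_node (graph G) -> X) :=
  {phi : knowledge -> X | forall (G : env) (x : bip_node (graph G)), F G x = phi (info T x)}.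

Lemma local_own : local 0 (fun G x => (is_vertex x, ident x, coins G x)).
Proof.
by exists (fun k => if k is Own v i _ s then (v, i, s) else
           let fix own k := match k with Own v i _ s => (v, i, s) | Learn k' _ => own k' end
           in own k).
Qed.

Lemma local_comp T (X Y : Type) (g : X -> Y) F F' :
  @local T X F -> (forall G x, F' G x = g (F G x)) -> @local T Y F'.
Proof. by case=> phi FE F'E; exists (fun k => g (phi k)) => G x; rewrite F'E FE. Qed.

Lemma local_pair T (X Y : Type) F F' :
  @local T X F -> @local T Y F' -> local T (fun G x => (F G x, F' G x)).
Proof.
by case=> phi FE [phi' FE']; exists (fun k => (phi k, phi' k)) => G x; rewrite FE FE'.
Qed.

Lemma local_leq T T' (X : Type) F : T <= T' -> @local T X F -> local T' F.
Proof.
move=> leT; rewrite -(subnK leT); elim: (T' - T) => // k IHk /IHk[phi FE].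
exists (fun t => if t is Learn t' _ then phi t' else phi t) => G x.
by rewrite addSn /= FE.
Qed.

Lemma local_nbrs T (X : Type) F : @local T X F ->
  local T.+1 (fun G x => [seq (ident y, F G y) | y <- nbrs x]).
Proof.
case=> phi FE.
exists (fun t => if t is Learn _ l then [seq (p.1, phi p.2) | p <- l] else [::]) => G x.
by rewrite /= -map_comp; apply: eq_map => y /=; rewrite FE.
Qed.

(** Flooding along walks of length at most [k], with harmless repetitions. The detour through pairs
    matches the form of [local_nbrs]. *)
Fixpoint gather (X : Type) (F : forall G : env, bip_node (graph G) -> seq X)
    (k : nat) (G : env) (x : bip_node (graph G)) : seq X :=
  if k is k'.+1
  then gather F k' x ++ flatten [seq p.2 | p <- [seq (ident y, gather F k' y) | y <- nbrs x]]
  else F G x.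

Lemma local_gather T (X : Type) F k :
  @local T (seq X) F -> local (T + k) (gather F k).
Proof.
move=> locF; elim: k => [|k IHk]; first by rewrite addn0.
rewrite addnS; have locN := local_nbrs IHk.
have locK := local_leq (leqnSn _) IHk.
exact: (local_comp (g := fun q => q.1 ++ flatten [seq p.2 | p <- q.2])
  (local_pair locK locN)).
Qed.

Lemma mem_nbrs (G : env) (x y : bip_node (graph G)) : (y \in nbrs x) = bip_adj x y.
Proof. by rewrite mem_sort mem_enum. Qed.

Lemma uniq_nbrs (G : env) (x : bip_node (graph G)) : uniq (nbrs x).
Proof. by rewrite sort_uniq enum_uniq. Qed.

Lemma nbrsC (G : env) (x y : bip_node (graph G)) : (y \in nbrs x) = (x \in nbrs y).
Proof. by rewrite !mem_nbrs; case: x y => [v|e] [u|e']. Qed.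

Lemma gather_leq (X : eqType) F k k' (G : env) (x : bip_node (graph G)) :
  k <= k' -> {subset (gather F k x : seq X) <= gather F k' x}.
Proof.
move/subnK<-; elim: (k' - k) => [//|i IHi] a /IHi ai.
by rewrite /= mem_cat ai.
Qed.

Lemma gather_step (X : eqType) F k (G : env) (x y : bip_node (graph G)) :
  y \in nbrs x -> {subset (gather F k y : seq X) <= gather F k.+1 x}.
Proof.
move=> yx a ay; rewrite /= mem_cat -map_comp; apply/orP; right.
by apply/flatten_mapP; exists y.
Qed.

Lemma gather_gather (X : eqType) F a b (G : env) (x : bip_node (graph G)) :
  gather (gather F a) b x = gather F (a + b) x :> seq X.
Proof.
elim: b x => [|b IHb] x; first by rewrite addn0.
by rewrite addnS /= IHb; congr (_ ++ flatten _); rewrite -!map_comp; apply: eq_map => y /=.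
Qed.

(** The walk that carried [a] from [y] to [x] can be reversed. Since [F'] is arbitrary, a center
    that has heard of a hyperedge can send its plan back to it. *)
Lemma mem_gather (X : eqType) F k (G : env) (x : bip_node (graph G)) (a : X) :
  a \in gather F k x -> exists y, a \in F G y /\
    forall (Y : eqType) (F' : forall G : env, bip_node (graph G) -> seq Y) b,
      b \in F' G x -> b \in gather F' k y.
Proof.
elim: k x => [|k IHk] x /=; first by exists x.
rewrite mem_cat -map_comp => /orP[/IHk[y [ay back]]|/flatten_mapP[z zx /IHk[y [ay back]]]].
  by exists y; split=> // Y F' b /back; apply: (gather_leq (leqnSn k)).
exists y; split=> // Y F' b bx.
have bz : b \in gather F' 1 z by apply: (gather_step (y := x)); rewrite // nbrsC.
by have := back _ (gather F' 1) b bz; rewrite gather_gather.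
Qed.

End LocalFunctionals.

Arguments gather : simpl never.

(** * The algorithm *)

Section Plans.

(* A record [(i, l)] describes a free hyperedge [i] with unsatisfied vertices
   [l]. A plan matches its vertices to hyperedges all of whose unsatisfied
   vertices belong to the plan. *)
Definition good_plan (v : nat) (recs : seq (nat * seq nat)) (M : seq (nat * nat)) :=
  [&& uniq (unzip1 M), uniq (unzip2 M), v \in unzip1 M &
    all (fun p => has (fun q => [&& q.1 == p.2, p.1 \in q.2 &
      all [in unzip1 M] q.2]) recs) M].

(** Local computation is unbounded, so any good plan may be chosen; it need not be the one that
    Hall's theorem provides. The empty plan stands for failure. *)
Definition solve v recs : seq (nat * nat) :=
  if pselect (exists M, good_plan v recs M) is left ex then xchoose ex else [::].

Lemma solveP v recs M : good_plan v recs M -> good_plan v recs (solve v recs).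
Proof.
move=> gM; rewrite /solve; case: pselect => [ex|[]]; first exact: xchooseP.
by exists M.
Qed.

Lemma mem_solve v recs p : p \in solve v recs -> good_plan v recs (solve v recs).
Proof. by rewrite /solve; case: pselect => // ex _; exact: xchooseP. Qed.

Definition lookup (M : seq (nat * nat)) (v : nat) := nth 0 (unzip2 M) (index v (unzip1 M)).

Lemma mem_lookup M v : v \in unzip1 M -> (v, lookup M v) \in M.
Proof.
move=> vM; have lt_i : index v (unzip1 M) < size M by rewrite -(size_map fst) index_mem.
have -> : (v, lookup M v) = nth (0, 0) M (index v (unzip1 M)); last exact: mem_nth.
rewrite /lookup (nth_map (0, 0)) // {1}(_ : v = (nth (0, 0) M (index v (unzip1 M))).1).
  by case: nth.
by rewrite -(nth_map _ 0) // nth_index.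
Qed.

Lemma lookup_inj M : uniq (unzip2 M) -> {in unzip1 M &, injective (lookup M)}.
Proof.
move=> uM v v' vM vM' /eqP; rewrite /lookup.
have sz : size (unzip2 M) = size (unzip1 M) by rewrite !size_map.
rewrite nth_uniq ?sz ?index_mem // => /eqP eqi.
by rewrite -(nth_index 0 vM) eqi nth_index.
Qed.

Definition first_plan (plans : seq (nat * seq (nat * nat))) :=
  (head (0, [::]) (sort (relpre fst leq) plans)).2.

Lemma first_planP (plans : seq (nat * seq (nat * nat))) : plans != [::] ->
  exists2 c, (c, first_plan plans) \in plans & forall p, p \in plans -> c <= p.1.
Proof.
move=> ne; have : sort (relpre fst leq) plans != [::].
  by rewrite -size_eq0 size_sort size_eq0.
have srt : sorted (relpre fst leq) (sort (relpre fst leq) plans).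
  by apply: sort_sorted => x y; exact: leq_total.
have mem p : (p \in sort (relpre fst leq) plans) = (p \in plans) by rewrite mem_sort.
rewrite /first_plan; case: (sort _ _) srt mem => [//|[c M] l] srt mem _ /=.
exists c; first by rewrite -mem inE eqxx.
move=> p; rewrite -mem inE => /orP[/eqP->//|pl].
have tr : transitive (relpre fst leq : rel (nat * seq (nat * nat))).
  by move=> y x z /=; exact: leq_trans.
by move: srt; rewrite /= path_sortedE // => /andP[/allP/(_ p pl)].
Qed.

End Plans.

Section Algorithm.

Variables k r d radius : nat.

Notation seed := ('I_k * 'I_(2 * r))%type.

Section Steps.

Variable G : env seed.
Notation node := (bip_node (graph G)).
Implicit Types x y : node.

Definition nbids x := [seq ident y | y <- nbrs x].

Definition slots x := [seq (ident y, (coins G y, nbids y)) | y <- nbrs x].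

(* A hyperedge splits its vertices into blocks of size [r] and keeps a random
   one; a vertex uses at most [d] of the hyperedges that kept it. *)
Definition taken x :=
  if is_vertex x
  then take d (unzip1 [seq p : nat * (seed * seq nat) <- slots x |
                        index (ident x) p.2.2 %/ r == p.2.1.1 :> nat])
  else [::].

(** [short], [alive] and [sated] are [bad], [live] and [sat] expressed by the identifiers and coins
    that a node receives. *)
Definition short x :=
  8 * count (fun p : nat * (seed * seq nat) => (p.1 \in taken x) && (r <= p.2.1.2)) (slots x) < d.

Definition alive x := ((coins G x).2 < r) &&
  all (fun p => (ident x \in p.2.1) ==> ~~ p.2.2)
    [seq (ident y, (taken y, short y)) | y <- nbrs x].

Definition sated x :=
  has (fun p : nat * (seed * seq nat * bool) => [&& p.1 \in taken x,
      p.2.1.1.2 == index (ident x) p.2.1.2 %% r :> nat & p.2.2])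
    [seq (ident y, (coins G y, nbids y, alive y)) | y <- nbrs x].

Definition claims x :=
  [seq p.1 | p <- [seq (ident y, (taken y, sated y)) | y <- nbrs x] &
    (ident x \in p.2.1) && ~~ p.2.2].

Definition record x := if alive x then [::] else [:: (ident x, claims x)].

End Steps.

Definition plan (G : env seed) (x : bip_node (graph G)) :=
  solve (ident x) (gather record radius x).

Definition announce (G : env seed) (x : bip_node (graph G)) := [:: (ident x, plan x)].

(** A vertex of a plan is one step beyond a hyperedge that the center has heard of, whence
    [radius.+1]. *)
Definition own (G : env seed) (x : bip_node (graph G)) :=
  lookup (first_plan [seq p <- gather announce radius.+1 x | ident x \in unzip1 p.2])
    (ident x).

Definition candidates (G : env seed) (x : bip_node (graph G)) :=
  [seq p.1 | p <- [seq (ident y, (taken y, sated y, own y)) | y <- nbrs x] &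
    (ident x \in p.2.1.1) &&
    (if alive x then (coins G x).2 == index p.1 (nbids x) %% r :> nat
     else ~~ p.2.1.2 && (p.2.2 == ident x))].

(** A hyperedge without candidate is outgoing for its first vertex, so that it is still oriented. *)
Definition decide (G : env seed) (x : bip_node (graph G)) : nat :=
  head (head 0 (nbids x)) (candidates x).

(** Five rounds produce the records, [radius] rounds collect them, [radius.+1] rounds announce the
    plans, and one more informs the hyperedges. *)
Lemma local_decide : local (2 * radius + 7) decide.
Proof.
have id0 : local 0 (fun (G : env seed) x => (is_vertex x, ident x, coins G x)).
  exact: local_own.
have up t T T' X F (l : @local t T X F) : T <= T' -> local T' F.
  by move=> le_T; exact: local_leq l.
have l_ids : local 1 nbids.
  apply: (local_comp (g := unzip1) (local_nbrs id0)) => G x.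
  by rewrite /nbids /unzip1 -map_comp.
have l_slots : local 2 slots.
  have l := local_nbrs (local_pair (up _ _ 1 _ _ id0 isT) l_ids).
  apply: (local_comp (g := fun l => [seq (p.1, (p.2.1.2, p.2.2)) | p <- l]) l) => G x.
  by rewrite -map_comp.
have l_taken : local 2 taken.
  apply: (local_comp (g := fun q => if q.1.1.1
    then take d (unzip1 [seq p : nat * (seed * seq nat) <- q.2 |
      index q.1.1.2 p.2.2 %/ r == p.2.1.1 :> nat]) else [::])
    (local_pair (up _ _ 2 _ _ id0 isT) l_slots)) => G x //.
have l_short : local 2 short.
  apply: (local_comp (g := fun q => 8 * count (fun p : nat * (seed * seq nat) =>
    (p.1 \in q.1) && (r <= p.2.1.2)) q.2 < d) (local_pair l_taken l_slots)) => G x //.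
have l_alive : local 3 alive.
  have l := local_nbrs (local_pair l_taken l_short).
  apply: (local_comp (g := fun q : bool * nat * seed * _ => (q.1.2.2 < r) &&
    all (fun p : nat * (seq nat * bool) => (q.1.1.2 \in p.2.1) ==> ~~ p.2.2) q.2)
    (local_pair (up _ _ 3 _ _ id0 isT) l)) => G x //.
have l_sated : local 4 sated.
  have l := local_nbrs (local_pair (up _ _ 3 _ _ id0 isT) (local_pair (up _ _ 3 _ _ l_ids isT) l_alive)).
  apply: (local_comp (g := fun q =>
    has (fun p : nat * (bool * nat * seed * (seq nat * bool)) => [&& p.1 \in q.2,
      p.2.1.2.2 == index q.1.1.1.2 p.2.2.1 %% r :> nat & p.2.2.2]) q.1.2)
    (local_pair (local_pair (up _ _ 4 _ _ id0 isT) l) (up _ _ 4 _ _ l_taken isT))) => G x /=.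
  by rewrite /sated !has_map.
have l_claims : local 5 claims.
  have l := local_nbrs (local_pair (up _ _ 4 _ _ l_taken isT) l_sated).
  apply: (local_comp (g := fun q =>
    unzip1 [seq p : nat * (seq nat * bool) <- q.2 | (q.1.1.2 \in p.2.1) && ~~ p.2.2])
    (local_pair (up _ _ 5 _ _ id0 isT) l)) => G x //.
have l_record : local 5 record.
  apply: (local_comp (g := fun q => if q.1.1 then [::] else [:: (q.1.2.1.2, q.2)])
    (local_pair (local_pair (up _ _ 5 _ _ l_alive isT) (up _ _ 5 _ _ id0 isT)) l_claims)) => G x //.
have l_plan : local (5 + radius) plan.
  apply: (local_comp (g := fun q => solve q.1.1.2 q.2)
    (local_pair (up _ _ (5 + radius) _ _ id0 isT) (local_gather radius l_record))) => G x //.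
have l_announce : local (5 + radius) announce.
  apply: (local_comp (g := fun q => [:: (q.1.1.2, q.2)])
    (local_pair (up _ _ (5 + radius) _ _ id0 isT) l_plan)) => G x //.
pose T := (2 * radius + 6)%N.
have l_own : local T own.
  have le_T : 5 + radius + radius.+1 <= T by rewrite /T; lia.
  apply: (local_comp (g := fun q => lookup (first_plan
      [seq p : nat * seq (nat * nat) <- q.2 | q.1.1.2 \in unzip1 p.2]) q.1.1.2)
    (local_pair (up _ _ T _ _ id0 isT) (up _ _ T _ _ (local_gather radius.+1 l_announce) le_T))) => G x //.
have le4 : 4 <= T by rewrite /T; lia.
have l := local_nbrs (local_pair (local_pair (up _ _ T _ _ l_taken (ltnW (ltnW le4)))
  (up _ _ T _ _ l_sated le4)) l_own).
have le3 : 3 <= T.+1 by rewrite /T; lia.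
have le1 : 1 <= T.+1 by [].
rewrite (_ : 2 * radius + 7 = T.+1); last by rewrite /T; lia.
apply: (local_comp (g := fun q : bool * nat * seed * _ * _ => head (head 0 q.2.1)
  [seq p.1 | p : nat * (seq nat * bool * nat) <- q.2.2 & (q.1.1.1.2 \in p.2.1.1) &&
    (if q.1.2 then q.1.1.2.2 == index p.1 q.2.1 %% r :> nat
     else ~~ p.2.1.2 && (p.2.2 == q.1.1.1.2))])
  (local_pair (local_pair (up _ _ T.+1 _ _ id0 isT) (up _ _ T.+1 _ _ l_alive le3))
     (local_pair (up _ _ T.+1 _ _ l_ids le1) l))) => G x //.
Qed.

End Algorithm.

(** * Correctness of the algorithm for fixed coins *)

Section Correctness.

Variables (k r d : nat) (G : env ('I_k * 'I_(2 * r))%type).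
Hypothesis ident_inj : injective (@ident _ G).

Notation H := (graph G).
Notation node := (bip_node H).

Definition kept (x y : node) := index (ident x) (nbids y) %/ r == (coins G y).1.

Definition links (v : vertex H) : {set node} :=
  [set y in take d [seq y <- nbrs (inl v : node) | kept (inl v) y]].

Definition slot (v : vertex H) (x : node) := index (ident (inl v : node)) (nbids x) %% r.

Definition choice : {ffun node -> 'I_(2 * r)} := [ffun x => (coins G x).2].

Lemma taken_vertex (v : vertex H) : taken d (inl v : node) =
  [seq ident y | y <- take d [seq y <- nbrs (inl v : node) | kept (inl v) y]].
Proof.
rewrite /taken /= map_take /slots filter_map /unzip1 -map_comp.
by congr take; apply: eq_map.
Qed.

Lemma mem_taken (v : vertex H) (x : node) : (ident x \in taken d (inl v : node)) = (x \in links v).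
Proof. by rewrite taken_vertex mem_map // inE. Qed.

Lemma links_nbrs (v : vertex H) x : x \in links v -> x \in nbrs (inl v : node).
Proof. by rewrite inE => /mem_take; rewrite mem_filter => /andP[]. Qed.

Lemma links_kept (v : vertex H) x : x \in links v -> kept (inl v) x.
Proof. by rewrite inE => /mem_take; rewrite mem_filter => /andP[]. Qed.

Lemma links_edge (v : vertex H) (x : node) : x \in links v ->
  exists2 e, x = inr e & v \in ends e.
Proof.
by case: x => [u|e] /links_nbrs; rewrite mem_nbrs // => ve; exists e.
Qed.

Lemma card_links (v : vertex H) :
  d <= size [seq y <- nbrs (inl v : node) | kept (inl v) y] -> #|links v| = d.
Proof.
move=> le_d; rewrite cardsE -[RHS](size_takel le_d); apply/card_uniqP.
by rewrite take_uniq ?filter_uniq ?uniq_nbrs.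
Qed.

Hypothesis r_gt0 : 0 < r.

Lemma slot_lt (v : vertex H) x : x \in links v -> slot v x < r.
Proof. by rewrite ltn_mod. Qed.

(** Vertices linked to [x] lie in the same block, so quotient and remainder by [r] determine the
    position in the list of identifiers. *)
Lemma slot_inj (u v : vertex H) x :
  x \in links u -> x \in links v -> slot u x = slot v x -> u = v.
Proof.
move=> ux vx eqs.
have /eqP eqb : index (ident (inl u : node)) (nbids x) %/ r ==
    index (ident (inl v : node)) (nbids x) %/ r.
  by rewrite (eqP (links_kept ux)) eq_sym; exact: links_kept vx.
have eqi : index (ident (inl u : node)) (nbids x) = index (ident (inl v : node)) (nbids x).
  by rewrite (divn_eq (index _ _) r) eqb -/(slot _ _) eqs -divn_eq.
have mem_ids w : x \in links w -> ident (inl w : node) \in nbids x.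
  by move/links_nbrs=> wx; apply: map_f; rewrite nbrsC.
have := nth_index 0 (mem_ids u ux); rewrite eqi (nth_index 0 (mem_ids v vx)).
by move/ident_inj; case.
Qed.

Lemma card_linked (x : node) : #|[set v | x \in links v]| <= r.
Proof.
have lt_slot v : slot v x < r by rewrite ltn_mod.
pose f v := Ordinal (lt_slot v).
suff <- : #|f @: [set v | x \in links v]| = #|[set v | x \in links v]|.
  by apply: leq_trans (max_card _) _; rewrite card_ord.
apply: card_in_imset => u v; rewrite in_set => ux; rewrite in_set => vx fuv.
by apply: slot_inj ux vx _; case: fuv.
Qed.

Lemma card_choice (v : vertex H) (P : nat -> bool) :
  count (fun p : nat * ('I_k * 'I_(2 * r) * seq nat) =>
      (p.1 \in taken d (inl v : node)) && P p.2.1.2) (slots (inl v : node)) =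
  #|[set x in links v | P (choice x)]|.
Proof.
rewrite count_map -size_filter -(card_uniqP _) ?filter_uniq ?uniq_nbrs //.
apply: eq_card => x; rewrite inE mem_filter /= mem_taken ffunE.
by apply/andP/idP => [[]//|vx]; split=> //; case/andP: vx => /links_nbrs.
Qed.

Lemma short_bad (v : vertex H) : short d (inl v : node) = bad links d choice v.
Proof. by rewrite /short (card_choice v (leq r)). Qed.

Lemma alive_live (x : node) : alive d x = live links d choice x.
Proof.
rewrite /alive /live ffunE; congr (_ && _); rewrite all_map.
apply/allP/forallP => [h v|h y _] /=.
  apply/implyP=> vx; have := h (inl v); rewrite -nbrsC links_nbrs // => /(_ isT).
  by rewrite /= mem_taken vx short_bad.
case: y => [v|e] //; rewrite mem_taken short_bad; exact: h.
Qed.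

Lemma sated_sat (v : vertex H) : sated d (inl v : node) = sat links slot d choice v.
Proof.
rewrite /sated has_map; apply/hasP/existsP => [[x xv]|[x]] /=.
  by rewrite mem_taken alive_live => h; exists x; rewrite ffunE.
case/and3P=> vx c l; exists x; first exact: links_nbrs.
by rewrite mem_taken vx alive_live l andbT; move: c; rewrite ffunE.
Qed.

Lemma mem_claims (x : node) a : reflect
  (exists2 v, a = ident (inl v : node) & v \in unsat_tips links slot d choice x)
  (a \in claims d x).
Proof.
apply: (iffP mapP) => [[[i q]]|[v -> ]].
  rewrite mem_filter /= => /andP[tk /mapP[[v|e] xy [-> qE]] ->]; move: tk; rewrite qE //=.
  by rewrite mem_taken sated_sat => tk; exists v => //; rewrite in_set.
rewrite inE -sated_sat => /andP[vx sv].
exists (ident (inl v : node), (taken d (inl v : node), sated d (inl v : node))) => //.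
rewrite mem_filter /= mem_taken vx sv /=.
by apply: map_f; rewrite -nbrsC links_nbrs.
Qed.

Lemma alive_decide (v : vertex H) : sat links slot d choice v -> forall radius,
  exists e, v \in ends e /\ decide d radius (inr e : node) = ident (inl v : node).
Proof.
case/existsP=> x /and3P[vx cx lx] radius; have [e xe ve] := links_edge vx.
subst x; exists e; split=> //; rewrite /decide.
set c := candidates _ _ _.
have vc : ident (inl v : node) \in c.
  apply/mapP; exists (ident (inl v : node), (taken d (inl v : node), sated d (inl v : node),
    own d radius (inl v : node))) => //.
  rewrite mem_filter /= mem_taken vx alive_live lx /=; move: cx; rewrite ffunE => -> /=.
  by apply: map_f; rewrite -nbrsC links_nbrs.
have c_eq a : a \in c -> a = ident (inl v : node).
  case/mapP=> -[i q]; rewrite mem_filter /= => /andP[tk /mapP[[u|e'] _ [iE qE]] ->] //.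
    move: tk; rewrite iE qE /= mem_taken alive_live lx => /andP[ux /eqP cu].
    congr (ident (inl _)); apply: slot_inj ux vx _.
    by rewrite /slot -cu; apply/eqP; move: cx; rewrite ffunE.
  by move: tk; rewrite qE.
case: c vc c_eq => // a c _ c_eq /=; apply: c_eq; exact: mem_head.
Qed.

Section Radius.

Variable t : nat.
(** A hop of the hypergraph is two steps of the bipartite graph; one more step reaches the
    hyperedges at the boundary of the ball. *)
Let radius := (2 * t).+1.

(** The induction absorbs the last hop into the functional, replacing [F] by [gather F 2]; hence the
    quantification over [F]. *)
Lemma hop_ball_gather (X : eqType)
    (F : forall G : env ('I_k * 'I_(2 * r))%type, bip_node (graph G) -> seq X) a
    (u v : vertex H) :
  u \in hop_ball (free links d choice) (unsat_tips links slot d choice) v t ->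
  a \in F G (inl u) -> a \in gather F (2 * t) (inl v : node).
Proof.
elim: t F u => [|i IHi] F u; first by rewrite inE => /eqP->.
rewrite [hop_ball _ _ _ i.+1]/= in_setU => /orP[ui aF|/bigcupP[x]].
  by apply: (gather_leq _ (IHi _ _ ui aF)); rewrite leq_mul2l leqnSn.
rewrite inE => /andP[_ /pred0Pn[z /andP[zx zi]]] ux aF; rewrite /= in zx zi.
have [uxl zxl] : x \in links u /\ x \in links z.
  by move: ux zx; rewrite !inE => /andP[-> _] /andP[-> _].
have ax : a \in gather F 1 x by apply: (gather_step (y := inl u)); rewrite // nbrsC links_nbrs.
have az : a \in gather F 2 (inl z : node) by apply: (gather_step (y := x)); rewrite ?links_nbrs.
have := IHi (gather F 2) z zi az; rewrite gather_gather.
by rewrite mulnS.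
Qed.

Lemma mem_plan (x : node) (a i : nat) : (a, i) \in plan d radius x ->
  exists v z, [/\ a = ident (inl v : node), i = ident z,
    v \in unsat_tips links slot d choice z,
    z \in free links d choice &
    {subset claims d z <= unzip1 (plan d radius x)} /\
    (ident x, plan d radius x) \in gather (announce d radius) radius.+1 (inl v : node)].
Proof.
move=> ai; have := mem_solve ai; rewrite -/(plan d radius x).
case/and4P=> _ _ _ /allP/(_ _ ai)/hasP[[i' l] rec /and3P[/eqP ii' al /allP sub]].
rewrite /= in ii' al sub.
have [z [zl back]] := mem_gather rec; move: zl; rewrite /record.
case: ifP => // az; rewrite mem_seq1 => /eqP[iz lz]; rewrite lz in al sub.
have /mem_claims[v av vz] := al.
exists v, z; split=> //; [by rewrite -ii' | by rewrite inE -alive_live az |].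
split; first by move=> b /sub.
have vzl : z \in links v by move: vz; rewrite inE => /andP[].
apply: (gather_step (y := z)); first exact: links_nbrs.
by apply: back; rewrite mem_seq1.
Qed.

(** Every plan containing [v] is heard by [v], so the center obeyed is minimal among all nodes whose
    plan contains [v]. This makes the comparison of two vertices in [own_inj] possible. *)
Lemma own_spec (v : vertex H) (x : node) : ident (inl v : node) \in unzip1 (plan d radius x) ->
  exists y : node, [/\ (ident (inl v : node), own d radius (inl v : node)) \in plan d radius y,
    own d radius (inl v : node) = lookup (plan d radius y) (ident (inl v : node)) &
    forall y' : node, ident (inl v : node) \in unzip1 (plan d radius y') -> ident y <= ident y'].
Proof.
have near (y : node) : ident (inl v : node) \in unzip1 (plan d radius y) ->
    (ident y, plan d radius y) \in [seq p <- gather (announce d radius) radius.+1 (inl v : node) |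
      ident (inl v : node) \in unzip1 p.2].
  move=> vy; rewrite mem_filter /= vy /=; case/mapP: vy => -[a i] ai /= va.
  have [u [z [au _ _ _ [_]]]] := mem_plan ai.
  by have -> : u = v by move: au; rewrite -va => /ident_inj[].
move=> vx; set L := [seq p <- _ | _] in near *.
have L0 : L != [::] by apply: contraTneq (near x vx) => ->.
have [c cL cmin] := first_planP L0.
move: (cL); rewrite mem_filter /= => /andP[vc /mem_gather[y [+ _]]].
rewrite mem_seq1 => /eqP[cy py].
exists y; rewrite /own -/L -py; split=> //; first by apply: mem_lookup.
by move=> y' /near/cmin; rewrite -cy.
Qed.

(* A vertex obeys the plan with the smallest identifier among the plans that
   contain it. A hyperedge assigned to two vertices by two plans has both
   vertices in both plans, so both vertices obey the same plan. *)
Lemma own_inj (u v : vertex H) (x y : node) :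
  ident (inl u : node) \in unzip1 (plan d radius x) ->
  ident (inl v : node) \in unzip1 (plan d radius y) ->
  own d radius (inl u : node) = own d radius (inl v : node) -> u = v.
Proof.
move=> /own_spec[x' [ux oux minx]] /own_spec[y' [vy ovy miny]] ouv.
have [u' [zu [uu' ozu uzu _ [subu _]]]] := mem_plan ux.
have [v' [zv [vv' ozv vzv _ [subv _]]]] := mem_plan vy.
have eu : u' = u by move: uu' => /ident_inj[].
have ev : v' = v by move: vv' => /ident_inj[].
have ez : zv = zu by apply: ident_inj; rewrite -ozu -ozv.
subst u' v' zv.
have vx : ident (inl v : node) \in unzip1 (plan d radius x').
  by apply: subu; apply/mem_claims; exists v.
have uy : ident (inl u : node) \in unzip1 (plan d radius y').
  by apply: subv; apply/mem_claims; exists u.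
have exy : x' = y'.
  by apply: ident_inj; apply/eqP; rewrite eqn_leq minx // miny.
subst y'; move: ouv; rewrite oux ovy.
have /and4P[_ uM _ _] := mem_solve ux.
move/(lookup_inj uM) => inj; have /ident_inj[] // : ident (inl u : node) = ident (inl v : node).
by apply: inj.
Qed.

(** The set and matching given by [small_balls_hall], written with identifiers, form a good plan for
    the records collected at [v]; hence [solve] does not fail there. *)
Lemma plan_center (s : nat) (v : vertex H) :
  (forall v, #|links v| = d) ->
  small_balls links slot d s t choice ->
  (8 * r) ^ t * (s * (d * r) ^ 3) < d ^ t ->
  ~~ sat links slot d choice v ->
  ident (inl v : node) \in unzip1 (plan d radius (inl v : node)).
Proof.
move=> deg sb big vU.
have [W [f [vW WB finj fW]]] := small_balls_hall deg card_linked sb big vU.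
pose M := [seq (ident (inl u : node), ident (f u)) | u <- enum W].
suff gM : good_plan (ident (inl v : node)) (gather (record d) radius (inl v : node)) M.
  by have /and4P[] := solveP gM.
have M1 : unzip1 M = [seq ident (inl u : node) | u <- enum W] by rewrite /unzip1 -map_comp.
apply/and4P; split.
- by rewrite M1 map_inj_uniq ?enum_uniq // => a b /ident_inj[].
- rewrite /unzip2 -map_comp map_inj_in_uniq ?enum_uniq // => a b.
  by rewrite !mem_enum => aW bW /= /ident_inj; apply: finj.
- by rewrite M1; apply: map_f; rewrite mem_enum.
apply/allP=> _ /mapP[u + ->]; rewrite mem_enum => uW /=.
have [fF uf fsub] := fW u uW; have ul : f u \in links u by move: uf; rewrite inE => /andP[].
apply/hasP; exists (ident (f u), claims d (f u)).
  have rf : (ident (f u), claims d (f u)) \in record d (f u).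
    by rewrite /record alive_live; move: fF; rewrite inE => /negPf->; rewrite mem_head.
  have ru : (ident (f u), claims d (f u)) \in gather (record d) 1 (inl u : node).
    by apply: (gather_step (y := f u)); rewrite ?links_nbrs.
  have := @hop_ball_gather _ (gather (record d) 1) _ u v (subsetP WB u uW) ru.
  by rewrite gather_gather add1n.
rewrite /= eqxx /=; apply/andP; split; first by apply/mem_claims; exists u.
apply/allP=> b /mem_claims[w -> wf]; rewrite /= M1; apply: (map_f (fun u : vertex H => ident (inl u : node))).
by rewrite mem_enum (subsetP fsub).
Qed.

(** An unsatisfied vertex outside all plans would read the default 0 from [lookup], possibly the
    identifier of this hyperedge. With all of them planned, [own_inj] leaves [v] as the only
    candidate. *)
Lemma unsat_decide (v : vertex H) (x : node) : ~~ sat links slot d choice v ->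
  ident (inl v : node) \in unzip1 (plan d radius x) ->
  (forall u, ~~ sat links slot d choice u ->
     exists y : node, ident (inl u : node) \in unzip1 (plan d radius y)) ->
  exists e, v \in ends e /\ decide d radius (inr e : node) = ident (inl v : node).
Proof.
move=> vU vx all_planned; have [y [vy _ _]] := own_spec vx.
have [v' [z [vv' oz vz zF _]]] := mem_plan vy.
have ev : v' = v by move: vv' => /ident_inj[].
subst v'; have vl : z \in links v by move: vz; rewrite inE => /andP[].
have [e ze ve] := links_edge vl; subst z; exists e; split=> //.
have dead : alive d (inr e : node) = false.
  by rewrite alive_live; move: zF; rewrite inE => /negPf.
rewrite /decide; set c := candidates _ _ _.
have vc : ident (inl v : node) \in c.
  apply/mapP; exists (ident (inl v : node), (taken d (inl v : node), sated d (inl v : node),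
    own d radius (inl v : node))) => //.
  rewrite mem_filter; apply/andP; split.
    by rewrite /= mem_taken vl dead sated_sat vU oz eqxx.
  by apply: map_f; rewrite -nbrsC links_nbrs.
have c_eq a : a \in c -> a = ident (inl v : node).
  case/mapP=> -[i q]; rewrite mem_filter /= => /andP[tk /mapP[[u|e'] _ [iE qE]] ->] //.
    move: tk; rewrite iE qE /= mem_taken dead sated_sat => /and3P[ux uU /eqP ou].
    have [y' uy'] := all_planned u uU.
    by congr (ident (inl _)); apply: own_inj uy' vx _; rewrite ou oz.
  by move: tk; rewrite qE.
case: c vc c_eq => // a c _ c_eq /=; apply: c_eq; exact: mem_head.
Qed.

Lemma decide_member (e : hyperedge H) :
  exists2 v, v \in ends e & decide d radius (inr e : node) = ident (inl v : node).
Proof.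
have : decide d radius (inr e : node) \in nbids (inr e : node).
  rewrite /decide; set c := candidates _ _ _.
  have sub : {subset c <= nbids (inr e : node)}.
    move=> a /mapP[[i q]]; rewrite mem_filter /= => /andP[_ /mapP[y ye [-> _]] ->].
    exact: map_f.
  case: c sub => [_|a c sub] /=; last by apply: sub; exact: mem_head.
  have /set0Pn[v ve] := ends_neq0 e.
  have : inl v \in nbrs (inr e : node) by rewrite mem_nbrs.
  by rewrite /nbids; case: (nbrs _) => // y l _; exact: mem_head.
case/mapP=> -[v|e'] ; rewrite mem_nbrs // => ve ->.
by exists v.
Qed.

Lemma decide_hso (s : nat) :
  (forall v, #|links v| = d) ->
  small_balls links slot d s t choice ->
  (8 * r) ^ t * (s * (d * r) ^ 3) < d ^ t ->
  is_hso (fun (v : vertex H) e => decide d radius (inr e : node) == ident (inl v : node)).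
Proof.
move=> deg sb big; apply/andP; split.
  apply/forallP=> e; have [v ve ->] := decide_member e.
  apply/cards1P; exists v; apply/setP=> u; rewrite !inE.
  apply/andP/eqP => [[_ /eqP/ident_inj[]]|->//].
  by [].
apply/forallP=> v; apply/existsP.
have planned u : ~~ sat links slot d choice u ->
    exists y : node, ident (inl u : node) \in unzip1 (plan d radius y).
  by move=> uU; exists (inl u); apply: plan_center sb big uU.
have [vS|vU] := boolP (sat links slot d choice v).
  by have [e [ve <-]] := alive_decide vS radius; exists e; rewrite ve eqxx.
have [x vx] := planned v vU.
by have [e [ve <-]] := unsat_decide vU vx planned; exists e; rewrite ve eqxx.
Qed.

End Radius.

End Correctness.

(** * Success probability and running time *)

Section Core.

Variable R : realType.
Local Open Scope ring_scope.

(** Conditioning on the first coins. Once the kept blocks are frozen, [links] and [slot] are fixed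
    and the shattering analysis applies to the second coins. *)
Lemma prob_pair (T A B : finType) (P : pred {ffun T -> A * B}) (eps : R) : 0 <= eps ->
  (forall a : {ffun T -> A},
     prob R (fun b : {ffun T -> B} => P [ffun x => (a x, b x)]) <= eps) ->
  prob R P <= eps.
Proof.
move=> eps0 Pa; pose g (ab : {ffun T -> A} * {ffun T -> B}) := [ffun x => (ab.1 x, ab.2 x)].
pose h (f : {ffun T -> A * B}) := ([ffun x => (f x).1], [ffun x => (f x).2]).
have gK : cancel g h by case=> a b; congr pair; apply/ffunP=> x; rewrite !ffunE.
have hK : cancel h g by move=> f; apply/ffunP=> x; rewrite !ffunE /=; case: (f x).
have bij_g : bijective g by exists h.
have [W0|W0] := posnP #|{: {ffun T -> A * B}}|.
  by rewrite /prob W0 invr0 mulr0.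
rewrite /prob ler_pdivrMr ?ltr0n //.
have cW : #|{: {ffun T -> A * B}}| = (#|{: {ffun T -> A}}| * #|{: {ffun T -> B}}|)%N.
  by rewrite !card_ffun card_prod expnMn.
have B0 : (0 < #|{: {ffun T -> B}}|)%N by move: W0; rewrite cW muln_gt0 => /andP[].
rewrite -sum1_card (reindex g) /=; last exact: onW_bij.
rewrite (eq_bigl (fun ab => true && P (g (ab.1, ab.2)))); last by case.
rewrite -(pair_big_dep xpredT (fun a b => P (g (a, b))) (fun _ _ => 1%N)).
rewrite natr_sum cW natrM /=.
rewrite mulrCA -[#|{: {ffun T -> A}}|]sum1_card natr_sum mulr_suml.
apply: ler_sum => a _; rewrite mul1r sum1_card.
by rewrite -ler_pdivrMr ?ltr0n //; exact: Pa.
Qed.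

Section Success.

Variables (k r d t : nat).

Definition hso_algorithm : local_algorithm bool nat :=
  full_info (2 * (2 * t).+1 + 7) (projT1 (local_decide k r d (2 * t).+1)).

Variables (H : hypergraph) (id : bip_node H -> nat).
Hypothesis id_inj : injective id.
Hypothesis k_gt0 : (0 < k)%N.
Hypothesis r_gt0 : (0 < r)%N.
Hypothesis d_gt0 : (0 < d)%N.

Notation coin_space := {ffun bip_node H -> 'I_k * 'I_(2 * r)}.

Definition sampled (w : coin_space) := [forall v : vertex H,
  d <= size [seq y <- nbrs (G := Env id w) (inl v) | kept (G := Env id w) (inl v) y]]%N.

Lemma hso_probE : hso_prob R hso_algorithm id =
  prob R (fun w : coin_space => is_hso (fun v e =>
    decide d (2 * t).+1 (G := Env id w) (inr e) == id (inl v))).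
Proof.
rewrite /hso_prob /success_prob /prob; congr (_%:R / _).
apply: eq_card => w; rewrite inE; congr is_hso.
apply: funext => v; apply: funext => e; congr (_ == _).
by rewrite (projT2 (local_decide k r d (2 * t).+1)) -(execute_full_info _ _ (G := Env id w)).
Qed.

Lemma links_eq (w w' : coin_space) : (forall x, (w x).1 = (w' x).1) ->
  links d (G := Env id w) = links d (G := Env id w') :> (vertex H -> {set bip_node H}).
Proof.
move=> ww'; apply: funext => v; apply/setP=> x; rewrite !inE.
congr (_ \in take d _); apply: eq_filter => y; by rewrite /kept /= ww'.
Qed.

Lemma sampled_eq (w w' : coin_space) : (forall x, (w x).1 = (w' x).1) ->
  sampled w = sampled w'.
Proof.
move=> ww'; apply: eq_forallb => v; congr (_ <= size _)%N.
by apply: eq_filter => y; rewrite /kept /= ww'.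
Qed.

Lemma hso_prob_ge (s : nat) (eps : R) : 0 <= eps ->
  (1 - (2 * r)%:R^-1) ^+ d <= eps -> (289%:R / 512%:R) ^+ d <= eps ^+ 2 ->
  (4 * (d * r) ^ 4)%:R * ((d * r).+1%:R * eps) <= 2^-1 ->
  ((8 * r) ^ t * (s * (d * r) ^ 3) < d ^ t)%N ->
  1 - (prob R (fun w => ~~ sampled w) + #|vertex H|%:R * 2^-1 ^+ s)
    <= hso_prob R hso_algorithm id.
Proof.
move=> eps0 e1 e2 e3 big; rewrite hso_probE.
pose bad_event (w : coin_space) := sampled w &&
  ~~ small_balls (links d (G := Env id w)) (slot (G := Env id w)) d s t (choice (Env id w)).
set good := fun w : coin_space => is_hso _.
have cover w : ~~ good w -> ~~ sampled w || bad_event w.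
  apply: contraNT; rewrite negb_or negbK => /andP[sw].
  rewrite /bad_event sw /= negbK => sb.
  apply: (decide_hso (G := Env id w) id_inj r_gt0 (s := s)) => // v.
  by apply: card_links; have /forallP := sw; apply.
have W0 : (0 < #|{: coin_space}|)%N.
  by rewrite card_ffun card_prod !card_ord expn_gt0 muln_gt0 k_gt0 muln_gt0 r_gt0.
have -> : prob R good = 1 - prob R (fun w => ~~ good w).
  by rewrite -(prob_predC R _ W0); apply: eq_prob => w; rewrite /= negbK.
rewrite lerD2l lerN2; apply: le_trans (prob_le R cover) _.
apply: le_trans (prob_predU R _ _) _; rewrite lerD2l.
set p := _ * eps in e3.
have p0 : 0 <= p by rewrite mulr_ge0.
apply: prob_pair => [|a]; first by rewrite mulr_ge0 ?exprn_ge0 ?invr_ge0 ?ler0n.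
have i0 : 'I_(2 * r) by exists 0%N; rewrite muln_gt0 r_gt0.
pose w0 : coin_space := [ffun x => (a x, i0)].
have [sw0|nsw0] := boolP (sampled w0); last first.
  rewrite (eq_prob R (Q := pred0)) ?prob_pred0 ?mulr_ge0 ?exprn_ge0 ?invr_ge0 //.
  move=> b; rewrite /bad_event (sampled_eq (w' := w0)) ?(negPf nsw0) // => x.
  by rewrite !ffunE.
have deg v : #|links d (G := Env id w0) v| = d.
  by apply: card_links; have /forallP := sw0; apply.
have rank := @card_linked _ _ d (Env id w0) id_inj r_gt0.
have lt_slot := @slot_lt _ _ d (Env id w0) r_gt0.
apply: (@le_trans _ _ (prob R (fun b : {ffun bip_node H -> 'I_(2 * r)} =>
  ~~ small_balls (links d (G := Env id w0)) (slot (G := Env id w0)) d s t b))).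
  apply: prob_le => b; rewrite /bad_event => /andP[_].
  rewrite (links_eq (w' := w0)); last by move=> x; rewrite !ffunE.
  have -> // : choice (Env id ([ffun x => (a x, b x)] : coin_space)) = b.
  by apply/ffunP=> x; rewrite !ffunE.
have unsat_p v := prob_unsat deg rank lt_slot d_gt0 r_gt0 v eps0 e1 e2.
apply: le_trans (prob_large_ball deg rank d_gt0 r_gt0 s t p0 unsat_p) _.
(* One factor [p] belongs to the root; each of the other [s] is paired with the choices for one
   forward move, which gives at most 1/2 per move. *)
rewrite -mulrA ler_wpM2l // exprS mulrCA -exprMn.
have p1 : p <= 1.
  have X1 : 1 <= (4 * (d * r) ^ 4)%:R :> R.
    by rewrite (ler_nat R 1) muln_gt0 expn_gt0 muln_gt0 d_gt0 r_gt0.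
  have := ler_wpM2r p0 X1; rewrite mul1r; lra.
have X0 : 0 <= (4 * (d * r) ^ 4)%:R * p by rewrite mulr_ge0.
rewrite -[leRHS]mul1r ler_pM ?exprn_ge0 //.
by apply: lerXn2r; rewrite ?nnegrE ?invr_ge0.
Qed.

Lemma size_nbrs_edge (w : coin_space) e :
  size (nbrs (G := Env id w) (inr e)) = #|ends e|.
Proof.
rewrite size_sort -cardE -(card_imset _ (@inl_inj (vertex H) (hyperedge H))).
apply: eq_card => -[v|e'] /=; first by rewrite mem_imset //; exact: inl_inj.
by apply/esym/negbTE/imsetP => -[].
Qed.

Lemma card_nbrs_vertex (v : vertex H) :
  #|[set x | @bip_adj H (inl v) x]| = degree v.
Proof.
rewrite /degree -(card_imset _ (@inr_inj (vertex H) (hyperedge H))).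
apply: eq_card => -[u|e] /=; rewrite !inE.
  by apply/esym/negbTE/imsetP => -[].
by rewrite mem_imset ?inE //; exact: inr_inj.
Qed.

Lemma size_sampled (w : coin_space) (v : vertex H) (P : pred (bip_node H)) :
  size [seq y <- nbrs (G := Env id w) (inl v) | P y] =
  #|[set y in [set x | @bip_adj H (inl v) x] | P y]|.
Proof.
have un := @uniq_nbrs _ (Env id w) (inl v).
rewrite -(card_uniqP _) ?filter_uniq //; apply: eq_card => y.
by rewrite !inE mem_filter (@mem_nbrs _ (Env id w)) andbC.
Qed.

Lemma index_nbrs (w : coin_space) (v : vertex H) (y : bip_node H) :
  (forall e : hyperedge H, #|ends e| <= k * r)%N -> @bip_adj H (inl v) y ->
  (index (id (inl v)) (nbids (G := Env id w) y) %/ r < k)%N.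
Proof.
case: y => // e rank ve; rewrite ltn_divLR //; apply: leq_trans (rank e).
rewrite -(@size_nbrs_edge w) -(size_map (@ident _ (Env id w))) index_mem.
by apply: map_f; rewrite mem_nbrs.
Qed.

Lemma sampled_all (w : coin_space) : k = 1%N ->
  (forall e : hyperedge H, #|ends e| <= k * r)%N -> (forall v : vertex H, d <= degree v)%N ->
  sampled w.
Proof.
move=> k1 rank deg; apply/forallP=> v; rewrite size_sampled.
apply: leq_trans (deg v) _; rewrite -card_nbrs_vertex; apply: subset_leq_card.
apply/subsetP=> y; rewrite !inE => vy; rewrite vy /kept /=.
have := index_nbrs w rank vy; have := ltn_ord (w y).1.
move: (_ %/ r)%N (nat_of_ord _) => a b lt_b lt_a.
by move: (leq_trans lt_b (eq_leq k1)) (leq_trans lt_a (eq_leq k1)); case: a b {lt_a lt_b} => [|a] [|b].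
Qed.

(** A hyperedge keeps the block of [v] with probability 1/k. [prob_count_le] is applied with x = 1/2
    and m = d - 1, followed by a union bound over the vertices. *)
Lemma prob_not_sampled (delta : nat) :
  (forall e : hyperedge H, #|ends e| <= k * r)%N ->
  (forall v : vertex H, delta <= degree v)%N ->
  prob R (fun w => ~~ sampled w) <=
    #|vertex H|%:R * (2%:R ^+ d * (1 - (2 * k)%:R^-1) ^+ delta).
Proof.
move=> rank deg.
pose J (v : vertex H) := [set x | @bip_adj H (inl v) x].
have i0 : 'I_(2 * r) by exists 0%N; rewrite muln_gt0 r_gt0.
have j0 : 'I_k by exists 0%N.
(* Dummy coins: the identifiers around a node do not depend on them. *)
pose w0 : coin_space := [ffun=> (j0, i0)].
pose Q (v : vertex H) (y : bip_node H) : pred ('I_k * 'I_(2 * r)) := fun c =>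
  (index (id (inl v)) (nbids (G := Env id w0) y) %/ r)%N == c.1 :> nat.
pose A (v : vertex H) (w : coin_space) := (#|[set y in J v | Q v y (w y)]| <= d.-1)%N.
have sub w : ~~ sampled w -> [exists v, A v w].
  case/forallPn=> v; rewrite -ltnNge size_sampled => lt_d; apply/existsP; exists v.
  by rewrite /A -ltnS prednK.
apply: le_trans (prob_le R sub) _; apply: le_trans (prob_exists R A) _.
rewrite mulr_natl -sumr_const; apply: ler_sum => v _.
have q0 : 0 <= 1 - (2 * k)%:R^-1 :> R.
  by rewrite subr_ge0 invf_le1 ?ltr0n ?(ler_nat R 1) muln_gt0.
have q1 : 1 - (2 * k)%:R^-1 <= 1 :> R by rewrite gerBl invr_ge0 ler0n.
have := @prob_count_le R (bip_node H) ('I_k * 'I_(2 * r))%type (J v) (Q v) 2^-1 k%:R^-1 d.-1.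
rewrite card_prod !card_ord muln_gt0 k_gt0 muln_gt0 r_gt0 => /(_ isT).
have -> : 1 - k%:R^-1 * (1 - 2^-1) = 1 - (2 * k)%:R^-1 :> R.
  have k0 : k%:R != 0 :> R by rewrite pnatr_eq0 -lt0n.
  by rewrite natrM; field.
move=> H0; have {H0} : prob R (A v) * 2^-1 ^+ d.-1 <= (1 - (2 * k)%:R^-1) ^+ #|J v|.
  apply: H0 => [|y]; first by lra.
  rewrite inE => vy; rewrite natrM mulrA mulVf ?mul1r ?pnatr_eq0 -?lt0n //.
  have lt_i := index_nbrs w0 rank vy.
  rewrite (_ : #|Q v y| = #|[predX pred1 (Ordinal lt_i) & predT : pred 'I_(2 * r)]|).
    by rewrite cardX card1 mul1n card_ord.
  by apply: eq_card => c; rewrite !inE /= andbT eq_sym.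
rewrite exprVn => le_A; have {}le_A : prob R (A v) <= (1 - (2 * k)%:R^-1) ^+ #|J v| * 2 ^+ d.-1.
  by rewrite -ler_pdivrMr ?exprn_gt0.
apply: le_trans le_A _; rewrite mulrC; apply: ler_pM.
- by rewrite exprn_ge0.
- by rewrite exprn_ge0.
- by rewrite ler_eXn2l ?ltr1n // leq_pred.
by apply: ler_wiXn2l; rewrite // card_nbrs_vertex.
Qed.

End Success.

End Core.

(** * Numerical estimates *)

Section Estimates.

Variable R : realType.
Local Open Scope ring_scope.
Implicit Types (x y : R) (n r d s k : nat).

Lemma ln2_ge : 1 / 2 <= ln 2 :> R.
Proof.
have h := @le_ln1Dx R (- (1 / 2)); rewrite -[2]invrK lnV ?posrE; last by lra.
have -> : 2^-1 = 1 + - (1 / 2) :> R by field.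
by have := h; lra.
Qed.

Lemma expR_ge_expn x n : -1 <= x -> (1 + x) ^+ n <= expR (n%:R * x).
Proof.
move=> x1; rewrite expRM_natl; apply: lerXn2r; rewrite ?nnegrE ?expR_ge0 //; first by lra.
exact: expR_ge1Dx.
Qed.

Lemma ln2_le : ln 2 <= 9 / 10 :> R.
Proof.
rewrite -ler_expR lnK ?posrE //.
have := @expR_ge_expn (9 / 20) 2; rewrite (_ : 2%:R * (9 / 20) = 9 / 10 :> R); last by field.
move=> h; apply: le_trans (h _); last by lra.
by rewrite expr2; lra.
Qed.

Lemma ln_ge1 n : (4 <= n)%N -> 1 <= ln n%:R :> R.
Proof.
move=> n4; apply: (@le_trans _ _ (ln (2 ^+ 2))).
  by rewrite lnXn // mulr2n; have := ln2_ge; lra.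
rewrite ler_ln ?posrE ?exprn_gt0 ?ltr0n //; last by apply: leq_trans n4.
by rewrite -natrX ler_nat.
Qed.

Lemma expRN_ln n m : (0 < n)%N -> expR (- (m%:R * ln n%:R)) = n%:R ^- m :> R.
Proof. by move=> n0; rewrite expRN expRM_natl lnK // posrE ltr0n. Qed.

(* Tangent of the logarithm at 320, with ln 320 < 9. *)
Lemma ln_le_tangent x : 320 <= x -> ln x <= 9 * x / 320.
Proof.
move=> x320; have x0 : 0 < x by lra.
have e : x = 320 * (1 + (x / 320 - 1)) by field.
have h : ln 320 <= 9 :> R.
  apply: (@le_trans _ _ (ln (2 ^+ 9))).
    by rewrite ler_ln ?posrE ?exprn_gt0 // -natrX ler_nat.
  by rewrite lnXn // -[leLHS]mulr_natr; have := ln2_le; lra.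
rewrite {1}e lnM ?posrE //; last by lra.
have h' : ln (1 + (x / 320 - 1)) <= x / 320 - 1 by apply: le_ln1Dx; lra.
lra.
Qed.

(** With x = d/r, the tangent bound gives ln x <= 9x/320, the second hypothesis gives ln r <= x/75,
    and 9/320 + 1/75 < 1/24. The factor 75 lies below the 79 that survives the sampling. *)
Lemma degree_condition r d : (0 < r)%N -> 320 * r%:R <= d%:R :> R ->
  75 * r%:R * ln r%:R <= d%:R :> R -> 24 * r%:R * ln d%:R <= d%:R :> R.
Proof.
move=> r0 d320 d75; have r0' : 0 < r%:R :> R by rewrite ltr0n.
pose x : R := d%:R / r%:R.
have dE : d%:R = x * r%:R :> R by rewrite /x divfK // gt_eqF.
have x320 : 320 <= x by rewrite ler_pdivlMr.
have lx := ln_le_tangent x320.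
have lr : ln r%:R <= x / 75 :> R.
  by rewrite ler_pdivlMr // mulrC ler_pdivlMr // mulrAC.
have -> : ln d%:R = ln x + ln r%:R :> R by rewrite dE lnM ?posrE //; lra.
rewrite dE -mulrA mulrCA mulrC ler_wpM2r ?ler0n //; lra.
Qed.

Section Core.

Variables r d : nat.
Hypothesis r2 : (2 <= r)%N.
Hypothesis d4 : (4 <= d)%N.
Hypothesis rd : 24 * r%:R * ln d%:R <= d%:R :> R.

Let d_gt0 : (0 < d)%N. Proof. exact: leq_trans d4. Qed.
Let r_gt0 : (0 < r)%N. Proof. exact: leq_trans r2. Qed.

Lemma degree_ge_24_rank : (24 * r <= d)%N.
Proof.
rewrite -(ler_nat R); apply: le_trans rd; rewrite natrM.
by rewrite -[leLHS]mulr1 ler_wpM2l ?ln_ge1 // mulr_ge0.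
Qed.

Lemma unchosen_bound : (1 - (2 * r)%:R^-1) ^+ d <= d%:R ^- 12 :> R.
Proof.
have h := @expR_ge_expn (- (2 * r)%:R^-1) d; apply: le_trans (h _) _.
  rewrite lerN2 invf_le1 ?ltr0n ?muln_gt0 //.
  by rewrite (ler_nat R 1) muln_gt0.
rewrite -(expRN_ln 12 d_gt0) ler_expR mulrN lerN2 ler_pdivlMr ?ltr0n ?muln_gt0 //.
by rewrite natrM; have := rd; lra.
Qed.

Lemma bad_bound : (289%:R / 512%:R) ^+ d <= (d%:R ^- 12) ^+ 2 :> R.
Proof.
apply: (@le_trans _ _ (expR (d%:R * - (1 / 2)))).
  rewrite expRM_natl; apply: lerXn2r; rewrite ?nnegrE ?expR_ge0 ?divr_ge0 //.
  (* 289/512 <= (7/8)^4 <= exp(-1/2). *)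
  have := @expR_ge_expn (- (1 / 8)) 4.
  rewrite (_ : 4%:R * - (1 / 8) = - (1 / 2) :> R); last by field.
  by move=> h; apply: le_trans (h _); rewrite ?exprS ?expr0; lra.
rewrite exprVn -exprM -(expRN_ln (12 * 2) d_gt0) ler_expR mulrN lerN2.
have r2' : 2 <= r%:R :> R by rewrite (ler_nat R 2).
have l0 : 0 <= ln d%:R :> R by have := ln_ge1 d4; lra.
have := ler_wpM2r l0 r2'; have := rd; lra.
Qed.

(** With dr + 1 <= d^2 and (dr)^4 <= d^8, the product is at most 4/d^2. *)
Lemma walk_bound : (4 * (d * r) ^ 4)%:R * ((d * r).+1%:R * d%:R ^- 12) <= 2^-1 :> R.
Proof.
have rd' := degree_ge_24_rank.
have d12 : 0 < d%:R ^+ 12 :> R by rewrite exprn_gt0 // ltr0n.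
rewrite mulrA ler_pdivrMr // [leRHS]mulrC ler_pdivlMr // -natrM -natrX -natrM ler_nat.
have le2 : ((d * r).+1 <= d ^ 2)%N by rewrite expnS expn1 ltn_pmul2l //; lia.
have le8 : ((d * r) ^ 4 <= d ^ 8)%N.
  rewrite (expnM d 2 4) leq_exp2r //; exact: ltnW.
have -> : (d ^ 12 = d ^ 2 * (d ^ 8 * d ^ 2))%N by rewrite -!expnD.
apply: (@leq_trans (4 * d ^ 8 * d ^ 2 * 2)).
  by rewrite leq_mul2r /= leq_mul // leq_mul2l le8 orbT.
have : (4 * 4 <= d ^ 2)%N by rewrite expnS expn1 leq_mul.
move: (d ^ 8)%N (d ^ 2)%N => a b lb.
have -> : (4 * a * b * 2 = 8 * (a * b))%N by lia.
by rewrite leq_mul2r; apply/orP; right; lia.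
Qed.

End Core.

(** An integer above the logarithm of s d^6 in base d/8r; d^6 bounds the factor (dr)^3 of the ball
    size. *)
Definition hall_radius s d r : nat :=
  (Num.truncn ((ln s%:R + 6 * ln d%:R) / ln (d%:R / (8 * r)%:R) : R)).+1.

Lemma hall_radiusP s d r : (0 < s)%N -> (0 < r)%N -> (8 * r < d)%N ->
  ((8 * r) ^ hall_radius s d r * (s * (d * r) ^ 3) < d ^ hall_radius s d r)%N.
Proof.
move=> s0 r0 rd; set t := hall_radius _ _ _.
have d0 : (0 < d)%N by apply: leq_ltn_trans rd.
have r8 : (0 < 8 * r)%N by rewrite muln_gt0.
have l0 : 0 < ln (d%:R / (8 * r)%:R) :> R.
  by rewrite ln_gt0 // ltr_pdivlMr ?ltr0n // mul1r ltr_nat.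
have lt_t : ln s%:R + 6 * ln d%:R < t%:R * ln (d%:R / (8 * r)%:R) :> R.
  by rewrite -ltr_pdivrMr // truncnS_gt.
apply: (@leq_ltn_trans ((8 * r) ^ t * (s * d ^ 6))).
  rewrite !leq_mul2l (expnM d 2 3) leq_exp2r // expnS expn1 leq_mul2l.
  by rewrite (_ : (r <= d)%N) ?orbT //; lia.
move: lt_t; move: (8 * r)%N r8 => a a0; rewrite ln_div ?posrE ?ltr0n // => lt_t.
have [s0' d0' a0'] : [/\ 0 < s%:R :> R, 0 < d%:R :> R & 0 < a%:R :> R].
  by rewrite !ltr0n.
rewrite -(ltr_nat R) !natrM !natrX -ltr_ln ?posrE ?mulr_gt0 ?exprn_gt0 //.
rewrite !lnM ?posrE ?mulr_gt0 ?exprn_gt0 // !lnXn //.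
by rewrite -[ln a%:R *+ t]mulr_natl -[ln d%:R *+ t]mulr_natl; lra.
Qed.

Lemma up_log_le n : (1 < n)%N -> (up_log 2 n)%:R <= 2 * log2 (n%:R : R).
Proof.
move=> n1; have l2 : 0 < ln 2 :> R by have := ln2_ge; lra.
have ln_n : ln 2 <= ln n%:R :> R by rewrite ler_ln ?posrE ?ltr0n ?ler_nat // ltnW.
have n_gt := up_log_gtn (isT : (1 < 2)%N) n1.
have : (up_log 2 n).-1%:R * ln 2 <= ln n%:R :> R.
  rewrite mulr_natl -lnXn // ler_ln ?posrE ?exprn_gt0 ?ltr0n //; last exact: ltnW.
  by rewrite -natrX ler_nat ltnW.
have u0 : (0 < up_log 2 n)%N by rewrite up_log_gt0.
have -> : (up_log 2 n)%:R = (up_log 2 n).-1%:R + 1 :> R by rewrite natr1 prednK.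
rewrite /log2 /logb mulrA ler_pdivlMr //; lra.
Qed.

Lemma half_pow_up_log n m : (0 < n)%N -> 2^-1 ^+ (m * up_log 2 n) <= n%:R ^- m :> R.
Proof.
move=> n0; rewrite exprVn lef_pV2 ?posrE ?exprn_gt0 ?ltr0n //.
rewrite mulnC exprM; apply: lerXn2r; rewrite ?nnegrE ?exprn_ge0 //.
by rewrite -natrX ler_nat up_logP.
Qed.

End Estimates.

(** * High probability, with and without sampling *)

Section Assembly.

Variable R : realType.
Local Open Scope ring_scope.

Lemma card_ends_rank (H : hypergraph) (e : hyperedge H) : (#|ends e| <= rank H)%N.
Proof. exact: leq_bigmax. Qed.

Lemma rank_le_card (H : hypergraph) : (rank H <= #|vertex H|)%N.
Proof. by apply/bigmax_leqP => e _; exact: max_card. Qed.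

Lemma min_degree_le (H : hypergraph) (v : vertex H) : (min_degree H <= degree v)%N.
Proof.
rewrite /min_degree; elim: (index_enum _) (mem_index_enum v) => // u l IHl.
rewrite inE big_cons geq_min => /orP[/eqP->|/IHl->]; by rewrite ?leqnn ?orbT.
Qed.

(* With hyperedges of a single vertex, any output orients them correctly. *)
Lemma hso_prob_rank1 k r d t (H : hypergraph) (id : bip_node H -> nat) :
  injective id -> (0 < k)%N -> (0 < r)%N -> (rank H <= 1)%N -> (0 < min_degree H)%N ->
  hso_prob R (hso_algorithm k r d t) id = 1.
Proof.
move=> id_inj k0 r0 rank1 deg0; rewrite hso_probE.
have W0 : (0 < #|{: {ffun bip_node H -> 'I_k * 'I_(2 * r)}}|)%N.
  by rewrite card_ffun card_prod !card_ord expn_gt0 muln_gt0 k0 muln_gt0 r0.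
rewrite (eq_prob R (Q := predT)); first by rewrite /prob divff // pnatr_eq0 -lt0n.
move=> w; apply/andP.
have single e : exists2 v, ends e = [set v] &
    decide d (2 * t).+1 (G := Env id w) (inr e) = id (inl v).
  have [v ve dv] := decide_member (G := Env id w) d t e.
  exists v => //; apply/eqP; rewrite eq_sym eqEcard sub1set ve cards1.
  exact: leq_trans (card_ends_rank e) rank1.
split.
  apply/forallP=> e; have [v ev ->] := single e.
  apply/cards1P; exists v; apply/setP=> u; rewrite ev !inE.
  by case: eqP => [->|//]; rewrite eqxx.
apply/forallP=> v; have := leq_trans deg0 (min_degree_le v).
case/card_gt0P=> e; rewrite inE => ve; apply/existsP; exists e; rewrite ve /=.
have [u eu ->] := single e; move: ve; rewrite eu inE => /eqP->; exact: eqxx.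
Qed.

Section HighProbability.

Variables (c : nat) (H : hypergraph) (id : bip_node H -> nat).
Hypothesis id_inj : injective id.
Let n := #|vertex H|.
Hypothesis n_gt1 : (1 < n)%N.
(** Then n 2^-s <= n^-(c+1): one power of n pays for the union bound over vertices, the other for
    adding the sampling and shattering errors. *)
Let s := ((c + 2) * up_log 2 n)%N.

Let n_gt0 : (0 < n)%N. Proof. exact: ltnW. Qed.

Let n_gt0R : 0 < n%:R :> R. Proof. by rewrite ltr0n. Qed.

Lemma repetitions_ge2 : (2 <= s)%N.
Proof. by rewrite /s -[2%N]muln1 leq_mul ?leq_addl // up_log_gt0. Qed.

Lemma hso_prob_whp k r d : (0 < k)%N -> (2 <= r)%N -> 320 * r%:R <= d%:R :> R ->
  75 * r%:R * ln r%:R <= d%:R :> R ->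
  prob R (fun w => ~~ @sampled k r d H id w) <= n%:R * n%:R ^- (c + 2) ->
  1 - (n%:R ^+ c)^-1 <= hso_prob R (hso_algorithm k r d (hall_radius R s d r)) id.
Proof.
move=> k0 r2 d320 d75 samp.
have r0 : (0 < r)%N by exact: ltnW.
have rd : (320 * r <= d)%N by rewrite -(ler_nat R) natrM.
have d4 : (4 <= d)%N by lia.
have d0 : (0 < d)%N by lia.
have cond := degree_condition r0 d320 d75.
have big : ((8 * r) ^ hall_radius R s d r * (s * (d * r) ^ 3) < d ^ hall_radius R s d r)%N.
  by apply: hall_radiusP => //; [exact: ltnW repetitions_ge2 | lia].
have e0 : 0 <= d%:R ^- 12 :> R by rewrite invr_ge0 exprn_ge0.
have bound := (hso_prob_ge id_inj k0 r0 d0 e0 (unchosen_bound r2 d4 cond)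
  (bad_bound r2 d4 cond) (walk_bound r2 d4 cond) big).
apply: le_trans bound.
rewrite lerD2l lerN2.
have half : n%:R * 2^-1 ^+ s <= n%:R * n%:R ^- (c + 2) :> R.
  by rewrite ler_wpM2l // half_pow_up_log.
apply: le_trans (lerD samp half) _.
have y0 : 0 < n%:R ^+ c :> R by rewrite exprn_gt0.
rewrite addn2 !exprS; set y := n%:R ^+ c in y0 *.
have -> : n%:R / (n%:R * (n%:R * y)) = n%:R^-1 * y^-1.
  by field; rewrite !gt_eqF.
have yV : 0 <= y^-1 by rewrite invr_ge0 ltW.
have nV : n%:R^-1 <= 2^-1 :> R by rewrite lef_pV2 ?posrE // (ler_nat R 2).
have := ler_wpM2r yV nV; lra.
Qed.

Lemma hso_prob_unsampled r d : (rank H <= r)%N -> (d <= min_degree H)%N ->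
  (2 <= r)%N -> 320 * r%:R <= d%:R :> R -> 75 * r%:R * ln r%:R <= d%:R :> R ->
  1 - (n%:R ^+ c)^-1 <= hso_prob R (hso_algorithm 1 r d (hall_radius R s d r)) id.
Proof.
move=> rank_r deg r2 d320 d75; apply: hso_prob_whp => //.
rewrite (eq_prob R (Q := pred0)) ?prob_pred0 ?mulr_ge0 ?invr_ge0 ?exprn_ge0 //.
move=> w; apply/negbTE; rewrite negbK; apply: sampled_all => //.
- exact: ltnW.
- by move=> e; rewrite mul1n; exact: leq_trans (card_ends_rank e) rank_r.
- by move=> v; exact: leq_trans deg (min_degree_le v).
Qed.

Lemma block_count r : (0 < s < r)%N ->
  (r <= (r %/ s).+1 * s)%N /\ ((r %/ s).+1 * s <= 2 * r)%N.
Proof.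
case/andP=> s0 lt_sr; split; first exact/ltnW/ltn_ceil.
rewrite mulSn mul2n -addnn; apply: leq_add; first exact: ltnW.
exact: leq_trunc_div.
Qed.

Section Sampled.

Variables r delta : nat.
Hypothesis s_lt_r : (s < r)%N.
Hypothesis log_r : 6 <= log2 (r%:R : R).
Hypothesis delta_ge : 320 * r%:R * log2 (r%:R : R) <= delta%:R.

Let k := (r %/ s).+1.
(** On average at least delta/k hyperedges keep the block of a given vertex; asking for half of them
    leaves room for a Chernoff bound. *)
Let d := (delta %/ (2 * k))%N.

Let s_gt0 : (0 < s)%N. Proof. exact: leq_trans repetitions_ge2. Qed.

Lemma mean_sampled_degree : 80 * s%:R * log2 (r%:R : R) <= delta%:R / (2 * k)%:R.
Proof.
have sr : (0 < s < r)%N by rewrite s_gt0.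
have [_ le_ks] := block_count sr.
rewrite ler_pdivlMr ?ltr0n //; apply: le_trans delta_ge.
have : (k * s)%:R <= (2 * r)%:R :> R by rewrite ler_nat.
rewrite !natrM => le_ks'.
have l0 : 0 <= 160 * log2 (r%:R : R) by have := log_r; lra.
have := ler_wpM2l l0 le_ks'; lra.
Qed.

Lemma sampled_degree_ge : 79 * s%:R * log2 (r%:R : R) <= d%:R.
Proof.
have k2 : (0 < 2 * k)%N by [].
have : delta%:R / (2 * k)%:R < d.+1%:R :> R.
  by rewrite ltr_pdivrMr ?ltr0n // -natrM ltr_nat ltn_ceil.
have s1 : 1 <= s%:R :> R by rewrite (ler_nat R 1).
have l0 : 0 <= log2 (r%:R : R) by have := log_r; lra.
have := ler_wpM2r l0 s1.
have := mean_sampled_degree; have := log_r; rewrite -natr1; lra.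
Qed.

(** With mu = delta/2k the left side is at most exp(mu ln 2 - mu) <= exp(-mu/10), and mu >= 80 s log
    r >= 480 s. *)
Lemma sampling_fails :
  2 ^+ d * (1 - (2 * k)%:R^-1) ^+ delta <= n%:R ^- (c + 2) :> R.
Proof.
apply: le_trans (half_pow_up_log R (c + 2) n_gt0); rewrite -/s.
have l2 : 0 < ln 2 :> R by have := ln2_ge R; lra.
have E m : 2 ^+ m = expR (m%:R * ln 2) :> R by rewrite expRM_natl lnK ?posrE.
rewrite exprVn !E -expRN.
have k1 : (2 * k)%:R^-1 <= 1 :> R by rewrite invf_le1 ?ltr0n // (ler_nat R 1).
have h : (1 - (2 * k)%:R^-1) ^+ delta <= expR (delta%:R * - (2 * k)%:R^-1) :> R.
  by apply: expR_ge_expn; rewrite lerN2.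
apply: le_trans (ler_wpM2l (expR_ge0 _) h) _; rewrite -expRD ler_expR mulrN.
have le_d : d%:R <= delta%:R / (2 * k)%:R :> R.
  by rewrite ler_pdivlMr ?ltr0n // -natrM ler_nat leq_trunc_div.
have s0 : 0 <= s%:R :> R by [].
have := ler_wpM2r (ltW l2) le_d.
have m0 := mean_sampled_degree; have l9 := ln2_le R.
have := ler_wpM2l s0 log_r; have := ler_wpM2l s0 l9.
set mu := delta%:R / _ in m0 le_d *.
have mu0 : 0 <= mu by apply: le_trans le_d.
have := ler_wpM2l mu0 l9; lra.
Qed.

Lemma sampled_conditions :
  320 * s%:R <= d%:R :> R /\ 75 * s%:R * ln s%:R <= d%:R :> R.
Proof.
have l2 : 0 < ln 2 :> R by have := ln2_ge R; lra.
have s0 : 0 <= s%:R :> R by [].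
have ge_d := sampled_degree_ge; have := ler_wpM2l s0 log_r => le_sl.
split; first lra.
have le_ln : ln s%:R <= log2 (r%:R : R).
  apply: (@le_trans _ _ (ln r%:R)).
    by rewrite ler_ln ?posrE ?ltr0n ?ler_nat ?(ltnW s_lt_r) //; exact: ltn_trans s_lt_r.
  rewrite /log2 /logb ler_pdivlMr // ler_piMr //; last by have := ln2_le R; lra.
  by rewrite ln_ge0 // (ler_nat R 1); exact: leq_ltn_trans s_lt_r.
have := ler_wpM2l s0 le_ln; lra.
Qed.

Lemma hso_prob_sampled : (rank H <= r)%N -> (delta <= min_degree H)%N ->
  1 - (n%:R ^+ c)^-1 <= hso_prob R (hso_algorithm k s d (hall_radius R s d s)) id.
Proof.
move=> rank_r deg; have [d320 d75] := sampled_conditions.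
apply: hso_prob_whp => //; first exact: repetitions_ge2.
have sr : (0 < s < r)%N by rewrite s_gt0.
have d0 : (0 < d)%N.
  rewrite -(ltr_nat R); apply: lt_le_trans d320.
  by rewrite mulr_gt0 // ltr0n.
have rank_e (e : hyperedge H) : (#|ends e| <= k * s)%N.
  apply: leq_trans (card_ends_rank e) (leq_trans rank_r _).
  by have [] := block_count sr.
have deg_v (v : vertex H) : (delta <= degree v)%N := leq_trans deg (min_degree_le v).
have k0 : (0 < k)%N by [].
apply: le_trans (prob_not_sampled R id k0 s_gt0 d0 rank_e deg_v) _.
by rewrite ler_wpM2l // sampling_fails.
Qed.

End Sampled.

End HighProbability.

End Assembly.

(** * Bounds on the number of rounds *)

Section Rounds.

Variable R : realType.
Variable c : nat.
Local Open Scope ring_scope.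

Let C : R := ln (2 * c + 4)%:R.

Lemma rounds_hso k r d t : rounds (hso_algorithm k r d t) = (4 * t + 9)%N.
Proof. by rewrite /=; lia. Qed.

Let ln2_gt0 : 0 < ln 2 :> R.
Proof. by have := ln2_ge R; lra. Qed.

Let C_ge0 : 0 <= C.
Proof. by rewrite ln_ge0 // (ler_nat R 1) addn4. Qed.

Lemma log2_ge1 n : (1 < n)%N -> 1 <= log2 (n%:R : R).
Proof.
move=> n1; rewrite /log2 /logb ler_pdivlMr // mul1r ler_ln ?posrE ?ltr0n ?ler_nat //.
exact: ltnW.
Qed.

Lemma ln_repetitions n : (1 < n)%N ->
  ln ((c + 2) * up_log 2 n)%:R <= C + ln (log2 (n%:R : R)).
Proof.
move=> n1; have l1 := log2_ge1 n1.
have u0 : (0 < up_log 2 n)%N by rewrite up_log_gt0.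
have p1 : 0 < ((c + 2) * up_log 2 n)%:R :> R by rewrite ltr0n muln_gt0 addn2.
have p2 : 0 < (2 * c + 4)%:R :> R by rewrite ltr0n addn4.
have p3 : 0 < log2 (n%:R : R) by lra.
have p23 : 0 < (2 * c + 4)%:R * log2 (n%:R : R) by exact: mulr_gt0.
rewrite -lnM ?posrE // ler_ln ?posrE // addn2 addn4.
rewrite natrM (_ : (2 * c).+4 = (c.+2 * 2)%N); last by lia.
by rewrite natrM -mulrA ler_wpM2l // up_log_le.
Qed.

Lemma hall_radius_le s d r : 0 <= ln s%:R + 6 * ln d%:R :> R ->
  0 < ln (d%:R / (8 * r)%:R) :> R ->
  (hall_radius R s d r)%:R * ln (d%:R / (8 * r)%:R) <=
    ln s%:R + 6 * ln d%:R + ln (d%:R / (8 * r)%:R) :> R.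
Proof.
move=> num0 den0; set x := (_ / _ : R) in den0 *; set y := ln s%:R + _ in num0 *.
have -> : (hall_radius R s d r)%:R = (Num.truncn (y / ln x))%:R + 1 :> R by rewrite natr1.
by rewrite mulrDl mul1r lerD2r -ler_pdivlMr // Num.Theory.truncn_le divr_ge0 // ltW.
Qed.

(** As d/r >= 64 = 8^2, replacing the base d/8r by d/r costs a factor 2. Then 65 = 48 + 8 + 9, from
    6 ln d, the rounding of the radius and the constant rounds. *)
Lemma rounds_le n r d : (1 < n)%N -> (2 <= r)%N -> (320 * r <= d)%N ->
  (rounds (hso_algorithm 1 r d (hall_radius R ((c + 2) * up_log 2 n) d r)))%:R <=
    (65 + 8 * C) * (logb (d%:R / r%:R) d%:R + logb (d%:R / r%:R) (log2 n%:R)).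
Proof.
move=> n1 r2 rd; rewrite rounds_hso; set s := ((c + 2) * _)%N.
have r0 : 0 < r%:R :> R by rewrite ltr0n; exact: ltnW.
have d4 : (4 <= d)%N by lia.
have d0 : 0 < d%:R :> R by rewrite ltr0n; lia.
have l1 := ln_ge1 R d4.
have rd' : 320 * r%:R <= d%:R :> R by rewrite -natrM ler_nat.
have lr0 : 0 <= ln r%:R :> R by rewrite ln_ge0 // (ler_nat R 1); exact: ltnW.
have ln8 : ln 8 = 3 * ln 2 :> R.
  by rewrite (_ : 8 = 2 ^+ 3 :> R); [rewrite lnXn // mulr_natl | ring].
set D := d%:R / r%:R : R.
have D0 : 0 < D by rewrite divr_gt0.
have lD : ln D = ln d%:R - ln r%:R by rewrite ln_div ?posrE.
have lD8 : ln (d%:R / (8 * r)%:R) = ln D - 3 * ln 2 :> R.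
  rewrite natrM ln_div ?posrE ?mulr_gt0 // lnM ?posrE // ln8 lD; lra.
have lD6 : 6 * ln 2 <= ln D.
  have -> : 6 * ln 2 = ln (2 ^+ 6) :> R by rewrite lnXn // mulr_natl.
  rewrite ler_ln ?posrE ?exprn_gt0 // ler_pdivlMr //.
  by rewrite (_ : 2 ^+ 6 = 64 :> R); [lra | ring].
have l2 := ln2_gt0.
have ls0 : 0 <= ln s%:R :> R.
  by rewrite ln_ge0 // (ler_nat R 1) muln_gt0 addn2 up_log_gt0.
have ls := ln_repetitions n1.
have := @hall_radius_le s d r; rewrite lD8.
set t : R := (hall_radius _ _ _ _)%:R => ht.
have {}ht : t * (ln D - 3 * ln 2) <= ln s%:R + 6 * ln d%:R + (ln D - 3 * ln 2).
  by apply: ht; lra.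
have lN := ln_ge0 (log2_ge1 n1).
have t0 : 0 <= t by [].
have lDp : 0 < ln D by lra.
rewrite /logb -mulrDl mulrA ler_pdivlMr // natrD natrM -/t.
have h1 : t * (ln D / 2) <= t * (ln D - 3 * ln 2) by rewrite ler_wpM2l //; lra.
have h2 : C <= C * ln d%:R by rewrite ler_peMr.
have h3 : 0 <= C * ln (log2 n%:R) by rewrite mulr_ge0.
rewrite -/s in ls; lra.
Qed.

Lemma log_over_loglog (N : R) : 4 <= N ->
  [/\ 2 <= log2 N, log2 N <= N &
      log2 N / log2 (log2 N) = ln N / ln (log2 N)].
Proof.
move=> N4; have N0 : 0 < N by lra.
have l2 := ln2_gt0; have l2g := ln2_ge R; have l2l := ln2_le R.
have lN2 : 2 * ln 2 <= ln N.
  have -> : 2 * ln 2 = ln (2 ^+ 2) :> R by rewrite lnXn // mulr_natl.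
  by rewrite ler_ln ?posrE ?exprn_gt0 // expr2; lra.
have M2 : 2 <= log2 N by rewrite /log2 /logb ler_pdivlMr.
have lM : 0 < ln (log2 N) by rewrite ln_gt0 //; lra.
split=> //; last by rewrite {1 2}/log2 /logb; field; rewrite !gt_eqF.
rewrite /log2 /logb ler_pdivrMr //.
have : ln (1 + (N / 4 - 1)) <= N / 4 - 1 by apply: le_ln1Dx; lra.
have -> : ln N = ln (2 ^+ 2) + ln (1 + (N / 4 - 1)).
  rewrite -lnM ?posrE ?exprn_gt0 //; last by lra.
  by congr ln; field.
rewrite lnXn // -mulr_natl.
have := ler_wpM2l (ltW N0) l2g; lra.
Qed.

(** The degree may be huge, but ln d = ln (d/8r) + ln 8r: the first term adds only a constant to the
    radius, and ln r <= ln s is of order log log n. Here 137 = 28 + 72 + 37, from 7 ln s, 6 ln 8 <=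
    18 and 4 * 7 + 9. *)
Lemma rounds_large_rank_le n k r d : (1 < n)%N -> 4 <= log2 (n%:R : R) ->
  (0 < r)%N -> (r <= (c + 2) * up_log 2 n)%N ->
  8 * r%:R * log2 (log2 n%:R) <= d%:R :> R ->
  (rounds (hso_algorithm k r d (hall_radius R ((c + 2) * up_log 2 n) d r)))%:R <=
    (137 + 28 * C) * (log2 (log2 n%:R) / log2 (log2 (log2 n%:R))).
Proof.
move=> n1 N4 r0 le_rs ge_d; rewrite rounds_hso.
have ls := ln_repetitions n1; set s := ((c + 2) * _)%N in le_rs ls *.
set N := log2 n%:R in N4 ge_d ls *.
have [M2 MN ->] := log_over_loglog N4; set M := log2 N in M2 MN ge_d *.
have r0' : 0 < r%:R :> R by rewrite ltr0n.
have r8 : 0 < (8 * r)%:R :> R by rewrite ltr0n muln_gt0.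
have M0 : 0 < M by lra.
have d0 : 0 < d%:R :> R.
  by apply: lt_le_trans ge_d; apply: mulr_gt0 => //; apply: mulr_gt0.
have m0 : 0 < ln M by rewrite ln_gt0 //; lra.
have le_l : ln M <= ln (d%:R / (8 * r)%:R).
  have q0 : 0 < d%:R / (8 * r)%:R :> R by exact: divr_gt0.
  by rewrite ler_ln ?posrE // ler_pdivlMr // natrM mulrC.
have lN1 : 1 <= ln N.
  apply: (@le_trans _ _ (ln (2 ^+ 2))); first by rewrite lnXn // mulr2n; have := ln2_ge R; lra.
  by rewrite ler_ln ?posrE ?exprn_gt0 // ?expr2; lra.
have lMN : ln M <= ln N by rewrite ler_ln ?posrE; lra.
have ln8 : ln 8 <= 3 :> R.
  rewrite (_ : 8 = 2 ^+ 3 :> R); last by ring.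
  by rewrite lnXn // -[leLHS]mulr_natl; have := ln2_le R; lra.
have lr0 : 0 <= ln r%:R :> R by rewrite ln_ge0 // (ler_nat R 1).
have lrs : ln r%:R <= ln s%:R :> R.
  by rewrite ler_ln ?posrE ?ltr0n ?ler_nat //; exact: leq_trans le_rs.
have ld : ln d%:R = ln (d%:R / (8 * r)%:R) + (ln 8 + ln r%:R) :> R.
  by rewrite ln_div ?posrE // natrM lnM ?posrE //; lra.
have ln80 : 0 <= ln 8 :> R by rewrite ln_ge0 // (ler_nat R 1 8).
have := @hall_radius_le s d r.
set l := ln (d%:R / _) in le_l ld *.
set t : R := (hall_radius _ _ _ _)%:R => ht.
have {}ht : t * l <= ln s%:R + 6 * ln d%:R + l by apply: ht; lra.
have l0 : 0 < l by lra.
rewrite mulrA ler_pdivlMr // natrD natrM -/t.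
(* Divide by l, then multiply by ln M <= l the terms that do not carry l. *)
have {}ht : (t - 7) * l <= ln s%:R + 6 * (ln 8 + ln r%:R) by lra.
have {}ht : (t - 7) * ln M <= ln s%:R + 6 * (ln 8 + ln r%:R).
  have [t7|t7] := lerP 0 (t - 7).
    by apply: le_trans ht; rewrite ler_wpM2l.
  apply: (@le_trans _ _ 0); last by lra.
  by rewrite mulr_le0_ge0 // ltW.
have h : C <= C * ln N by rewrite ler_peMr.
lra.
Qed.

End Rounds.

Local Open Scope ring_scope.

Theorem theorem1p9 (R : realType) (c : nat) :
  (exists (K : R) (A : nat -> nat -> nat -> local_algorithm bool nat),
    forall (H : hypergraph) (n r delta : nat),
      #|vertex H| = n -> rank H = r -> min_degree H = delta ->
      (1 < n)%N -> (r < delta)%N ->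
      320 * r%:R * log2 (r%:R : R) <= delta%:R ->
      (rounds (A n r delta))%:R <=
        K * (logb (delta%:R / r%:R) delta%:R +
             logb (delta%:R / r%:R) (log2 n%:R)) /\
      (forall id : bip_node H -> nat, injective id ->
        1 - (n%:R ^+ c)^-1 <= hso_prob R (A n r delta) id))
  /\
  (exists (K : R) (A : nat -> nat -> nat -> local_algorithm bool nat),
    forall (H : hypergraph) (n r delta : nat),
      #|vertex H| = n -> rank H = r -> min_degree H = delta ->
      (1 < n)%N ->
      320 * r%:R * log2 (r%:R : R) <= delta%:R ->
      100 * log2 (n%:R : R) <= r%:R ->
      (rounds (A n r delta))%:R <=
        K * (log2 (log2 n%:R) / log2 (log2 (log2 n%:R))) /\
      (forall id : bip_node H -> nat, injective id ->
        1 - (n%:R ^+ c)^-1 <= hso_prob R (A n r delta) id)).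
Proof.
pose s n := ((c + 2) * up_log 2 n)%N.
have l2 : 0 < ln 2 :> R by have := ln2_ge R; lra.
have l2' := ln2_le R.
have ln_le_log2 (m : nat) : (0 < m)%N -> ln m%:R <= log2 (m%:R : R).
  move=> m0; rewrite /log2 /logb ler_pdivlMr // ler_piMr //; last by lra.
  by rewrite ln_ge0 // (ler_nat R 1).
split.
  (* For r = 1 the bound 320 r log r vanishes and the estimates break down, but every output is then
     correct, so radius 0 suffices. *)
  exists (65 + 8 * ln (2 * c + 4)%:R), (fun n r delta =>
    if (r <= 1)%N then hso_algorithm 1 1 1 0
    else hso_algorithm 1 r delta (hall_radius R (s n) delta r)).
  move=> H n r delta nE rE dE n1 rd large.
  have r0 : (0 < r)%N.
    have /card_gt0P[v _] : (0 < #|vertex H|)%N by rewrite nE ltnW.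
    have : (0 < degree v)%N.
      by apply: leq_trans (min_degree_le v); rewrite dE; exact: leq_ltn_trans rd.
    case/card_gt0P=> e _; rewrite -rE; apply: leq_trans (card_ends_rank e).
    by rewrite card_gt0 ends_neq0.
  have [r1|r2] := leqP r 1.
    have er : r = 1%N by apply/eqP; rewrite eqn_leq r1 r0.
    split=> [|id id_inj].
      have ld : 0 < ln delta%:R :> R by rewrite ln_gt0 // (ltr_nat R 1) -er.
      rewrite rounds_hso /= er divr1 /logb divff ?gt_eqF //.
      have lN := ln_ge0 (log2_ge1 R n1).
      have C0 : 0 <= ln (2 * c + 4)%:R :> R by rewrite ln_ge0 // (ler_nat R 1) addn4.
      have q0 : 0 <= ln (log2 n%:R) / ln delta%:R :> R by rewrite divr_ge0 // ltW.
      have := mulr_ge0 C0 q0; lra.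
    rewrite hso_prob_rank1 ?rE ?dE //; last exact: leq_ltn_trans rd.
    by rewrite gerBl invr_ge0 exprn_ge0.
  have L1 := log2_ge1 R r2.
  have r0' : 0 <= r%:R :> R by [].
  have := ler_wpM2l r0' L1; have := ler_wpM2l r0' (ln_le_log2 r r0) => le_rl le_r.
  split=> [|id id_inj].
    by apply: rounds_le => //; rewrite -(ler_nat R) natrM; lra.
  rewrite -nE /s; apply: hso_prob_unsampled; rewrite ?nE ?rE ?dE //; first lra.
  have := ler_wpM2l r0' L1; lra.
(* If r <= s n, then ln r is already of order log log n and the whole hyperedges are kept; otherwise
   blocks of size [s n] are sampled. *)
exists (137 + 28 * ln (2 * c + 4)%:R), (fun n r delta =>
  if (r <= s n)%N then hso_algorithm 1 r delta (hall_radius R (s n) delta r)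
  else hso_algorithm (r %/ s n).+1 (s n) (delta %/ (2 * (r %/ s n).+1))
    (hall_radius R (s n) (delta %/ (2 * (r %/ s n).+1)) (s n))).
move=> H n r delta nE rE dE n1 large rank_large.
have N1 := log2_ge1 R n1.
have r100 : (100 <= r)%N by rewrite -(ler_nat R); lra.
have r0 : (0 < r)%N by lia.
have log_ge6 (m : nat) : (100 <= m)%N -> 6 <= log2 (m%:R : R).
  move=> m100; rewrite /log2 /logb ler_pdivlMr // mulr_natl -lnXn //.
  rewrite ler_ln ?posrE ?exprn_gt0 ?ltr0n //; last by lia.
  by rewrite -natrX ler_nat; lia.
have L6 := log_ge6 r r100.
have N6 : 6 <= log2 (n%:R : R).
  by apply: log_ge6; apply: leq_trans r100 _; rewrite -rE -nE rank_le_card.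
(* This turns the factor log r in the degree into a ratio of degree to rank of at least order log
   log n, the base needed for the running time. *)
have ML : log2 (log2 n%:R) <= log2 (r%:R : R).
  have le_Nr : log2 (n%:R : R) <= r%:R by lra.
  have N0 : 0 < log2 (n%:R : R) by lra.
  rewrite [leLHS]/log2 [leRHS]/log2 /logb ler_wpM2r ?invr_ge0 ?(ltW l2) //.
  by rewrite ler_ln ?posrE // ltr0n.
have r0' : 0 <= r%:R :> R by [].
have := ler_wpM2l r0' ML; have := ler_wpM2l r0' L6.
have := ler_wpM2l r0' (ln_le_log2 r r0) => le_rl le_r le_rM.
have N4 : 4 <= log2 (n%:R : R) by lra.
have [r_small|s_lt_r] := leqP r (s n).
  split=> [|id id_inj].
    by apply: rounds_large_rank_le => //; have := mulr_ge0 r0' r0'; lra.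
  have r2 : (2 <= r)%N by exact: leq_trans r100.
  have d320 : 320 * r%:R <= delta%:R :> R by have := mulr_ge0 r0' r0'; lra.
  have d75 : 75 * r%:R * ln r%:R <= delta%:R :> R by lra.
  rewrite -nE /s; apply: hso_prob_unsampled => //; rewrite ?nE ?rE ?dE //.
have n1' : (1 < #|vertex H|)%N by rewrite nE.
split=> [|id id_inj].
  apply: rounds_large_rank_le => //.
    by apply: ltnW; rewrite -nE; exact: repetitions_ge2.
  rewrite -/(s n).
  have ge_d := @sampled_degree_ge R c H n1' r delta.
  rewrite nE -/(s n) in ge_d; have {}ge_d := ge_d s_lt_r L6 large.
  have s0 : 0 <= (s n)%:R :> R by [].
  have := ler_wpM2l s0 ML; have := ler_wpM2l s0 L6; lra.
have := @hso_prob_sampled R c H id id_inj n1' r delta.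
by rewrite nE -/(s n) => prob_ge; apply: prob_ge; rewrite ?rE ?dE.
Qed.
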